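(* Let $\mathcal{H}=\{H(G): G \text{ a finite simple graph}\}$. Then $$\mathcal{H}\cap[0,4]=\{0,1,2,5/2,3,7/2,11/3,4\}.$$
   Context: For an integer $q \ge 2$ let $[q]=\{0,\dots,q-1\}$. For $f=(f_1,\dots,f_n):[q]^n\to[q]^n$, the interaction graph $\mathrm{IG}(f)$ is the digraph on $\{1,\dots,n\}$ with an arc $(u,v)$ iff $f_v$ depends essentially on $x_u$ (there exist $a,b\in[q]^n$ differing only in coordinate $u$ with $f_v(a)\ne f_v(b)$). A simple graph is viewed as the digraph with both arcs for each edge and no loops. The $q$-guessing number is $\mathrm{gn}(G,q)=\max\{\log_q|\mathrm{Fix}(f)| : \mathrm{IG}(f)\subseteq G\}$, where $\mathrm{Fix}(f)=\{x:f(x)=x\}$, and the entropy is $H(G)=\sup_{q\ge2}\mathrm{gn}(G,q)$. *)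

(* Defs.v *)
From mathcomp Require Import all_boot.
From Stdlib Require Import Reals.
Set Implicit Arguments. Unset Strict Implicit. Unset Printing Implicit Defensive.

Definition simple_graph (n : nat) (e : rel 'I_n) : Prop :=
  (forall u v, e u v = e v u) /\ (forall u, e u u = false).

Definition config (n q : nat) := {ffun 'I_n -> 'I_q}.

Definition depends (n q : nat) (f : config n q -> config n q) (u v : 'I_n) : Prop :=
  exists a b : config n q, (forall w, w != u -> a w = b w) /\ f a v <> f b v.

Definition IG_sub (n q : nat) (f : config n q -> config n q) (e : rel 'I_n) : Prop :=
  forall u v, depends f u v -> e u v.

Definition nfix (n q : nat) (f : config n q -> config n q) : nat :=
  #|[set x : config n q | f x == x]|.

Definition logfix (n q : nat) (f : config n q -> config n q) : R :=
  (ln (INR (nfix f)) / ln (INR q))%R.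

Definition is_gn (n : nat) (e : rel 'I_n) (q : nat) (r : R) : Prop :=
  (exists f : config n q -> config n q, IG_sub f e /\ logfix f = r) /\
  (forall f : config n q -> config n q, IG_sub f e -> (logfix f <= r)%R).

Definition is_entropy (n : nat) (e : rel 'I_n) (h : R) : Prop :=
  is_lub (fun r => exists q : nat, (2 <= q)%N /\ is_gn e q r) h.

(* Main.v *)
(** A fractional clique cover gives a lower bound on the entropy: let every clique
    impose a parity check on its members, each vertex carrying one bit per clique;
    some syndrome class is a large set of fixed points. Shannon entropy of the
    uniform distribution on the fixed points is a polymatroid, whence upper bounds
    by submodularity.

    If some independent set has fewer neighbours than elements, a minimal one yields
    a crown: an independent set I whose neighbourhood S is matched into I. Deleting
    I and S lowers both bounds by exactly |S|. If there is none, Hall's theorem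
    gives a permutation sending every vertex to a neighbour, so the graph is spanned
    by disjoint edges and odd cycles and its entropy is at least half the number of
    vertices. Only graphs on at most 7 vertices spanned in this way remain, and an
    exhaustive search shows that each of them has entropy at least 4 or lies between
    a spanning subgraph with a good cover and one of a few explicit maximal graphs.
    The value 11/3 comes from a triangle joined to one further vertex by three
    internally disjoint paths of length 2. *)
From HB Require Import structures.
Require Import Defs.
From mathcomp Require Import all_boot.
From Stdlib Require Import Reals Lra Classical.
From mathcomp Require Import ssrnat.
Set Implicit Arguments. Unset Strict Implicit. Unset Printing Implicit Defensive.

(** * Shannon entropy of a set of fixed points *)

Definition nbrs (V : finType) (e : rel V) (v : V) : {set V} := [set u | e u v].

(** The Shannon inequalities for entropy, scaled so that one vertex carries at most 1; the last
    clause says that a vertex is determined by its neighbours. *)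
Definition polymatroid (V : finType) (e : rel V) (h : {set V} -> R) : Prop :=
  [/\ h set0 = 0%R,
      forall A B : {set V}, A \subset B -> (h A <= h B)%R,
      forall A B : {set V}, (h (A :|: B) + h (A :&: B) <= h A + h B)%R,
      forall v, (h [set v] <= 1)%R
    & forall v, (h (v |: nbrs e v) <= h (nbrs e v))%R].

(** Codes are the subsets of fixed-point sets of functions with interaction graph inside [e], over
    an arbitrary finite alphabet. *)
Definition code (V A : finType) (e : rel V) (F : {set {ffun V -> A}}) : Prop :=
  forall x y v, x \in F -> y \in F -> (forall u, e u v -> x u = y u) -> x v = y v.

HB.instance Definition _ := Monoid.isComLaw.Build R 0%R Rplus
  (fun x y z => esym (Rplus_assoc x y z)) Rplus_comm Rplus_0_l.
HB.instance Definition _ := Monoid.isMulLaw.Build R 0%R Rmult Rmult_0_l Rmult_0_r.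
HB.instance Definition _ := Monoid.isAddLaw.Build R Rmult Rplus
  (fun x y z => Rmult_plus_distr_r x y z) (fun x y z => Rmult_plus_distr_l x y z).

Lemma rsum_le (I : finType) (P : pred I) (f g : I -> R) :
  (forall i, P i -> (f i <= g i)%R) ->
  (\big[Rplus/0%R]_(i | P i) f i <= \big[Rplus/0%R]_(i | P i) g i)%R.
Proof.
move=> le_fg; apply: (big_ind2 (fun a b => (a <= b)%R)) => //.
  exact: Rle_refl.
by move=> x1 x2 y1 y2; apply: Rplus_le_compat.
Qed.

Lemma rsumD (I : finType) (P : pred I) (f g : I -> R) :
  \big[Rplus/0%R]_(i | P i) (f i + g i)%R =
  (\big[Rplus/0%R]_(i | P i) f i + \big[Rplus/0%R]_(i | P i) g i)%R.
Proof. exact: big_split. Qed.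

Lemma rsumZ (I : finType) (P : pred I) (a : R) (f : I -> R) :
  \big[Rplus/0%R]_(i | P i) (a * f i)%R = (a * \big[Rplus/0%R]_(i | P i) f i)%R.
Proof. by rewrite -big_distrr. Qed.

Lemma rsum_const (I : finType) (A : {pred I}) (a : R) :
  \big[Rplus/0%R]_(i in A) a = (INR #|A| * a)%R.
Proof.
rewrite big_const; elim: #|A| => [|k IH]; first by rewrite /=; lra.
by rewrite iterS IH S_INR; lra.
Qed.

Lemma rsum_indicator (I : finType) (P Q : pred I) (f : I -> R) :
  \big[Rplus/0%R]_(i | P i && Q i) f i =
  \big[Rplus/0%R]_(i | P i) (INR (Q i) * f i)%R.
Proof.
rewrite big_mkcondr; apply: eq_bigr => i _.
by case: (Q i); rewrite /= ?Rmult_1_l ?Rmult_0_l.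
Qed.

Lemma ln_le_sub1 (x : R) : (0 < x)%R -> (ln x <= x - 1)%R.
Proof.
move=> x0; have := exp_ineq1_le (ln x); rewrite exp_ln //; lra.
Qed.

Definition agree (V A : finType) (S : {set V}) (x y : {ffun V -> A}) : bool :=
  [forall v in S, x v == y v].

Lemma agreeP (V A : finType) (S : {set V}) (x y : {ffun V -> A}) :
  reflect (forall v, v \in S -> x v = y v) (agree S x y).
Proof. exact: eqfun_inP. Qed.

Lemma agree_refl (V A : finType) (S : {set V}) (x : {ffun V -> A}) : agree S x x.
Proof. by apply/agreeP. Qed.

Lemma agree_sym (V A : finType) (S : {set V}) (x y : {ffun V -> A}) :
  agree S x y = agree S y x.
Proof. by apply/agreeP/agreeP=> H v vS; rewrite H. Qed.

Lemma agree_trans (V A : finType) (S : {set V}) : transitive (@agree V A S).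
Proof. by move=> y x z /agreeP H1 /agreeP H2; apply/agreeP=> v vS; rewrite H1 ?H2. Qed.

Lemma agreeU (V A : finType) (S T : {set V}) (x y : {ffun V -> A}) :
  agree (S :|: T) x y = agree S x y && agree T x y.
Proof.
apply/agreeP/andP => [H|[/agreeP H1 /agreeP H2] v].
  by split; apply/agreeP=> v vS; apply: H; rewrite inE vS ?orbT.
by rewrite inE => /orP[/H1|/H2].
Qed.

Lemma agreeS (V A : finType) (S T : {set V}) (x y : {ffun V -> A}) :
  S \subset T -> agree T x y -> agree S x y.
Proof. by move=> /subsetP ST /agreeP H; apply/agreeP=> v /ST /H. Qed.

Definition fiber (V A : finType) (F : {set {ffun V -> A}}) (S : {set V})
  (x : {ffun V -> A}) : R := INR #|[pred y in F | agree S x y]|.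

Lemma fiber_gt0 (V A : finType) (F : {set {ffun V -> A}}) (S : {set V}) x :
  x \in F -> (0 < fiber F S x)%R.
Proof.
move=> xF; apply: lt_0_INR; apply/ltP/card_gt0P.
by exists x; rewrite inE /= xF agree_refl.
Qed.

Lemma fiber_eq (V A : finType) (F : {set {ffun V -> A}}) (S : {set V}) x y :
  agree S x y -> fiber F S x = fiber F S y.
Proof.
move=> xy; congr INR; apply: eq_card => z; rewrite !inE; congr (_ && _).
by apply/idP/idP; apply: agree_trans; rewrite // agree_sym.
Qed.

Lemma fiber_sum (V A : finType) (F : {set {ffun V -> A}}) (S : {set V}) x :
  \big[Rplus/0%R]_(y in F) INR (agree S x y) = fiber F S x.
Proof.
rewrite /fiber -[RHS]Rmult_1_r -rsum_const rsum_indicator.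
by apply: eq_bigr => y _; rewrite Rmult_1_r.
Qed.

(* The left-hand side counts the [S]-agreement classes of [F] that meet [P], weighted
   by the fraction of the class that lies in [P]; there is at most one. *)
Lemma class_sum_le (V A : finType) (F : {set {ffun V -> A}}) (S : {set V})
    (P : pred {ffun V -> A}) :
  (forall x y, P x -> P y -> agree S x y) ->
  (\big[Rplus/0%R]_(x in F) (INR (P x) * / fiber F S x) <= 1)%R.
Proof.
move=> Pagree.
have [x0 /andP[x0F Px0]|noP] := pickP [pred x in F | P x]; last first.
  rewrite big1 ?Rle_0_1 //; first exact: Rle_0_1.
  by move=> x xF; have := noP x; rewrite inE /= xF /= => ->; rewrite Rmult_0_l.
have f0 := fiber_gt0 S x0F.
apply: (Rle_trans _ (\big[Rplus/0%R]_(x in F) (INR (agree S x0 x) * / fiber F S x0))%R).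
  apply: rsum_le => x xF; case Px: (P x); last first.
    rewrite Rmult_0_l; apply: Rmult_le_pos; first exact: pos_INR.
    by apply: Rlt_le; apply: Rinv_0_lt_compat.
  have a := Pagree _ _ Px0 Px; rewrite a (fiber_eq F a); exact: Rle_refl.
rewrite -big_distrl /= fiber_sum Rinv_r; [exact: Rle_refl | exact: Rgt_not_eq].
Qed.

(** The inequality [ln p <= p - 1], summed over [F]; it plays the part of Jensen's inequality in
    both entropy bounds below. *)
Lemma gibbs (I : finType) (F : {set I}) (p : I -> R) :
  (forall x, x \in F -> (0 < p x)%R) ->
  (\big[Rplus/0%R]_(x in F) p x <= INR #|F|)%R ->
  (\big[Rplus/0%R]_(x in F) ln (p x) <= 0)%R.
Proof.
move=> p0 sp.
apply: (Rle_trans _ (\big[Rplus/0%R]_(x in F) (p x + -1)%R)).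
  by apply: rsum_le => x xF; have := ln_le_sub1 (p0 x xF); lra.
by rewrite rsumD rsum_const; lra.
Qed.

(** [ln #|F| - lnfib F S / #|F|] is the Shannon entropy of the restriction to [S] of a uniformly
    random element of [F]. *)
Definition lnfib (V A : finType) (F : {set {ffun V -> A}}) (S : {set V}) : R :=
  \big[Rplus/0%R]_(x in F) ln (fiber F S x).

Lemma lnfib_anti (V A : finType) (F : {set {ffun V -> A}}) (S T : {set V}) :
  S \subset T -> (lnfib F T <= lnfib F S)%R.
Proof.
move=> ST; apply: rsum_le => x xF.
have: (fiber F T x <= fiber F S x)%R.
  apply/le_INR/leP/subset_leq_card/subsetP=> y; rewrite !inE => /andP[-> H].
  exact: agreeS H.
case=> [lt|->]; last exact: Rle_refl.
by apply/Rlt_le/ln_increasing => //; apply: fiber_gt0.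
Qed.

Lemma lnfib_supermodular (V A : finType) (F : {set {ffun V -> A}}) (S T : {set V}) :
  (lnfib F S + lnfib F T <= lnfib F (S :|: T) + lnfib F (S :&: T))%R.
Proof.
pose c := fiber F.
have c0 U x : x \in F -> (0 < c U x)%R by apply: fiber_gt0.
have ic0 U x : x \in F -> (0 < / c U x)%R by move=> xF; apply/Rinv_0_lt_compat/c0.
(* [p] is the ratio of the coupling that makes [S] and [T] conditionally independent over [S :&: T]
   to the true marginal on [S :|: T]. *)
pose p x := (c S x * c T x * (/ c (S :|: T) x * / c (S :&: T) x))%R.
have p0 x : x \in F -> (0 < p x)%R.
  by move=> xF; do ?[apply: Rmult_lt_0_compat]; auto.
suff sp: (\big[Rplus/0%R]_(x in F) p x <= INR #|F|)%R.
  have := gibbs p0 sp.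
  have -> : \big[Rplus/0%R]_(x in F) ln (p x) =
      (lnfib F S + lnfib F T + (-1 * lnfib F (S :|: T) + -1 * lnfib F (S :&: T)))%R.
    rewrite (eq_bigr (fun x => ln (c S x) + ln (c T x) +
       (-1 * ln (c (S :|: T) x) + -1 * ln (c (S :&: T) x)))%R); last first.
      move=> x xF; rewrite !ln_mult ?ln_Rinv; auto; try (by do ?[apply: Rmult_lt_0_compat]; auto).
      by ring.
    by rewrite !rsumD !rsumZ.
  by move=> H; lra.
(* Expand [c S x] and [c T x] as sums over [y] and [z], then sum over [x] first: the [x] that agree
   with [y] on [S] and with [z] on [T] lie in one class for [S :|: T], of weight at most 1. *)
rewrite (eq_bigr (fun x => \big[Rplus/0%R]_(y in F) \big[Rplus/0%R]_(z in F)
   (INR (agree (S :&: T) y z) * / c (S :&: T) y *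
     (INR (agree S x y && agree T x z) * / c (S :|: T) x))))%R; last first.
  move=> x xF; rewrite /p /c -(fiber_sum F S) -(fiber_sum F T) big_distrlr /= big_distrl /=.
  apply: eq_bigr => y yF; rewrite big_distrl /=; apply: eq_bigr => z zF.
  case xy: (agree S x y) => /=; last by ring.
  case xz: (agree T x z) => /=; last by ring.
  have I1: agree (S :&: T) x y by apply: agreeS xy; apply: subsetIl.
  have I2: agree (S :&: T) x z by apply: agreeS xz; apply: subsetIr.
  rewrite (agree_trans (y := x)) // 1?agree_sym // (fiber_eq F I1) /=; ring.
rewrite exchange_big /=.
have -> : INR #|F| = \big[Rplus/0%R]_(y in F) 1%R by rewrite rsum_const Rmult_1_r.
apply: rsum_le => y yF; rewrite exchange_big /=.
apply: (Rle_trans _ (\big[Rplus/0%R]_(z in F)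
   (INR (agree (S :&: T) y z) * / c (S :&: T) y)))%R.
  apply: rsum_le => z zF; rewrite -big_distrr /=.
  rewrite -[X in (_ <= X)%R]Rmult_1_r; apply: Rmult_le_compat_l.
    by apply: Rmult_le_pos; [exact: pos_INR | apply/Rlt_le/ic0].
  apply: (@class_sum_le _ _ F (S :|: T) (fun x => agree S x y && agree T x z)) => x x'.
  move=> /andP[a b] /andP[a' b']; rewrite agreeU.
  by apply/andP; split; [apply: (agree_trans a) | apply: (agree_trans b)]; rewrite agree_sym.
rewrite -big_distrl /= fiber_sum Rinv_r; [exact: Rle_refl | exact/Rgt_not_eq/c0].
Qed.

(** Gibbs' inequality for [p x = #|F| / (#|A| * c x)]: the sum of [/ c x] counts the values taken at
    [v], at most [#|A|]. *)
Lemma lnfib_set1 (V A : finType) (F : {set {ffun V -> A}}) (v : V) :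
  (0 < #|F|)%N ->
  (INR #|F| * (ln (INR #|F|) - ln (INR #|A|)) <= lnfib F [set v])%R.
Proof.
move=> Fgt0; have [x0 x0F] := card_gt0P Fgt0.
have f0 : (0 < INR #|F|)%R by apply: lt_0_INR; apply/ltP.
have a0 : (0 < INR #|A|)%R.
  by apply: lt_0_INR; apply/ltP/card_gt0P; exists (x0 v).
pose c := fiber F [set v].
have c0 x : x \in F -> (0 < c x)%R by apply: fiber_gt0.
pose k := (INR #|F| * / INR #|A|)%R.
have k0 : (0 < k)%R by apply: Rmult_lt_0_compat => //; apply: Rinv_0_lt_compat.
have ic0 x : x \in F -> (0 < / c x)%R by move=> xF; apply/Rinv_0_lt_compat/c0.
have: (\big[Rplus/0%R]_(x in F) ln (k * / c x) <= 0)%R.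
  apply: gibbs => [x xF|]; first by apply: Rmult_lt_0_compat; auto.
  rewrite -big_distrr /=.
  have: (\big[Rplus/0%R]_(x in F) / c x <= INR #|A|)%R.
    rewrite (eq_bigr (fun x : {ffun V -> A} =>
      \big[Rplus/0%R]_(a : A) (INR (x v == a) * / c x))%R); last first.
      move=> x _; rewrite (bigD1 (x v)) //= eqxx big1 /=; first by ring.
      by move=> a; rewrite eq_sym => /negbTE ->; rewrite /= Rmult_0_l.
    rewrite exchange_big /=.
    have -> : INR #|A| = \big[Rplus/0%R]_(a : A) 1%R by rewrite -[LHS]Rmult_1_r -rsum_const.
    apply: rsum_le => a _; apply: (@class_sum_le _ _ F [set v] (fun x : {ffun V -> A} => x v == a)).
    move=> x y /eqP xa /eqP ya.
    by apply/agreeP=> w /set1P ->; rewrite xa ya.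
  move=> /(Rmult_le_compat_l _ _ _ (Rlt_le _ _ k0)); rewrite /k.
  rewrite (Rmult_assoc _ (/ _) (INR #|A|)) Rinv_l; last exact: Rgt_not_eq.
  by rewrite Rmult_1_r.
have -> : \big[Rplus/0%R]_(x in F) ln (k * / c x) =
    (INR #|F| * (ln (INR #|F|) - ln (INR #|A|)) + -1 * lnfib F [set v])%R.
  rewrite (eq_bigr (fun x => (ln (INR #|F|) - ln (INR #|A|)) + -1 * ln (c x))%R); last first.
    move=> x xF; rewrite /k !ln_mult ?ln_Rinv; auto; last by apply: Rinv_0_lt_compat.
    by ring.
  by rewrite rsumD rsum_const rsumZ.
by move=> H; lra.
Qed.

Lemma code_polymatroid (V A : finType) (e : rel V) (F : {set {ffun V -> A}}) :
  (0 < #|F|)%N -> (1 < #|A|)%N -> code e F ->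
  exists2 h, polymatroid e h & h setT = (ln (INR #|F|) / ln (INR #|A|))%R.
Proof.
move=> Fgt0 Agt1 Fcode.
have f0 : (0 < INR #|F|)%R by apply: lt_0_INR; apply/ltP.
have l0 : (0 < ln (INR #|A|))%R.
  by rewrite -ln_1; apply: ln_increasing; [exact: Rlt_0_1 | apply: (lt_INR 1); apply/ltP].
pose w := (/ INR #|F| * / ln (INR #|A|))%R.
have w0 : (0 < w)%R by apply: Rmult_lt_0_compat; apply: Rinv_0_lt_compat.
have wF : (w * INR #|F| = / ln (INR #|A|))%R.
  by rewrite /w; field; split; apply: Rgt_not_eq.
(* Entropy in base [#|A|]. On [setT] all fibres are singletons; on [nbrs e v] and [v |: nbrs e v]
   the fibres coincide because [F] is a code. *)
pose h S := (w * (INR #|F| * ln (INR #|F|) - lnfib F S))%R.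
exists h; last first.
  rewrite /h /lnfib big1 ?Rminus_0_r; last first.
    move=> x xF; rewrite -[RHS]ln_1; congr ln; rewrite /fiber.
    rewrite -[RHS]/(INR 1); congr INR; rewrite -(card1 x); apply: eq_card => y.
    rewrite !inE; apply/andP/eqP => [[_ /agreeP H]|->]; last by rewrite xF agree_refl.
    by apply/ffunP=> v; rewrite H.
  by rewrite -Rmult_assoc wF /Rdiv; ring.
split.
- rewrite /h /lnfib (eq_bigr (fun=> ln (INR #|F|))); last first.
    move=> x xF; congr (ln (INR _)); apply: eq_card => y; rewrite !inE.
    by case: (y \in F) => //=; apply/agreeP => v; rewrite inE.
  by rewrite rsum_const; ring.
- move=> S T /(lnfib_anti F) ST; apply: Rmult_le_compat_l; lra.
- move=> S T; have := lnfib_supermodular F S T; rewrite /h => st.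
  by rewrite -!Rmult_plus_distr_l; apply: Rmult_le_compat_l; lra.
- move=> v; have := lnfib_set1 v Fgt0 => Hv.
  apply: (Rle_trans _ (w * (INR #|F| * ln (INR #|A|)))%R).
    by apply: Rmult_le_compat_l; lra.
  by rewrite -Rmult_assoc wF Rinv_l; [exact: Rle_refl | exact: Rgt_not_eq].
- move=> v; rewrite /h /lnfib.
  rewrite (eq_bigr (fun x => ln (fiber F (nbrs e v) x))); first exact: Rle_refl.
  move=> x xF; congr (ln (INR _)); apply: eq_card => y; rewrite !inE.
  case yF: (y \in F) => //=; rewrite agreeU; apply/andP/idP => [[]//|H]; split=> //.
  apply/agreeP => u /set1P ->; apply: Fcode => // t tv.
  by have /agreeP := H; apply; rewrite inE.
Qed.

(** * Lower bounds from clique covers *)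

Definition shannon_bound (V : finType) (e : rel V) (r : R) : Prop :=
  forall h, polymatroid e h -> (h setT <= r)%R.

(* A fractional clique cover of weight #|K| / m: every vertex occupies m of the
   #|K| cliques, and [t v] lists the cliques occupied by [v]. *)
Definition clique_cover (V : finType) (e : rel V) (r : R) : Prop :=
  exists m (K : finType) (t : V -> 'I_m -> K),
  [/\ 0 < m, forall v, injective (t v),
      forall u v i j, t u i = t v j -> u = v \/ e u v
    & r = (INR #|V| - INR #|K| / INR m)%R].

Definition syndrome (V K : finType) (m : nat) (t : V -> 'I_m -> K)
    (x : {ffun V -> {ffun 'I_m -> bool}}) : {ffun K -> bool} :=
  [ffun c => \big[addb/false]_(v : V) \big[addb/false]_(i | t v i == c) x v i].

(** Bit [j] of vertex [v] is recovered from the parity of the clique [t v j]: by injectivity it is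
    the only bit of [v] there, and the other bits belong to neighbours. *)
Lemma syndrome_code (V K : finType) (m : nat) (e : rel V) (t : V -> 'I_m -> K) s :
  (forall v, injective (t v)) ->
  (forall u v i j, t u i = t v j -> u = v \/ e u v) ->
  code e [set x | syndrome t x == s].
Proof.
move=> tinj tclq x y v; rewrite !inE => /eqP xs /eqP ys xy; apply/ffunP => j.
have: syndrome t x (t v j) = syndrome t y (t v j) by rewrite xs ys.
rewrite !ffunE (bigD1 v) //= [in RHS](bigD1 v) //=.
rewrite !(big_pred1 j); try by move=> i; rewrite /= (inj_eq (tinj v)).
rewrite (eq_bigr (fun u => \big[addb/false]_(i | t u i == t v j) y u i)); first by move/addIb.
move=> u uv; apply: eq_bigr => i /eqP /tclq [ E|euv]; first by rewrite E eqxx in uv.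
by rewrite xy.
Qed.

Lemma pigeonhole_fiber (T U : finType) (f : T -> U) :
  0 < #|U| -> exists u, #|T| <= #|[set x | f x == u]| * #|U|.
Proof.
move=> /card_gt0P [u0 _].
have [u umax] : exists u, forall w, #|[set x | f x == w]| <= #|[set x | f x == u]|.
  by exists [arg max_(u > u0) #|[set x | f x == u]|]; case: arg_maxnP => // u _ H w; apply: H.
exists u; rewrite -[#|T|]sum1_card (partition_big f predT) //=.
rewrite mulnC -sum_nat_const [leqRHS](eq_bigl predT) //; apply: leq_sum => w _.
by rewrite sum1_card (leq_trans _ (umax w)) // -cardsE.
Qed.

Lemma parity_code (V K : finType) (m : nat) (e : rel V) (t : V -> 'I_m -> K) :
  (forall v, injective (t v)) ->
  (forall u v i j, t u i = t v j -> u = v \/ e u v) ->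
  exists2 F : {set {ffun V -> {ffun 'I_m -> bool}}}, code e F &
    2 ^ (m * #|V|) <= #|F| * 2 ^ #|K|.
Proof.
move=> tinj tclq.
have [|s Hs] := pigeonhole_fiber (syndrome t).
  by apply/card_gt0P; exists [ffun=> false].
exists [set x | syndrome t x == s]; first exact: syndrome_code.
by move: Hs; rewrite !card_ffun card_bool card_ord expnM.
Qed.

Lemma INR_expn (a k : nat) : INR (a ^ k) = (INR a ^ k)%R.
Proof. by elim: k => [|k IH] //; rewrite expnS mult_INR IH. Qed.

Lemma ln_INR_gt0 q : 1 < q -> (0 < ln (INR q))%R.
Proof.
move=> q1; rewrite -ln_1; apply: ln_increasing; first exact: Rlt_0_1.
by apply: (lt_INR 1); apply/ltP.
Qed.

Lemma ln_INR_le a b : 0 < a -> a <= b -> (ln (INR a) <= ln (INR b))%R.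
Proof.
move=> a0 /leP /le_INR [lt|->]; last exact: Rle_refl.
by apply/Rlt_le/ln_increasing => //; apply: lt_0_INR; apply/ltP.
Qed.

(** The largest syndrome class has at least [2 ^ (m * #|V|) / 2 ^ #|K|] elements, over an alphabet
    of size [2 ^ m]. *)
Lemma clique_cover_code (V : finType) (e : rel V) r : clique_cover e r ->
  exists A : finType, 1 < #|A| /\
  exists F : {set {ffun V -> A}},
    [/\ code e F, 0 < #|F| & (r <= ln (INR #|F|) / ln (INR #|A|))%R].
Proof.
case=> m [K [t [m0 tinj tclq ->]]].
exists {ffun 'I_m -> bool}; rewrite card_ffun card_bool card_ord.
split; first by rewrite -{1}(expn0 2) ltn_exp2l.
have [F Fc FK] := parity_code tinj tclq; exists F.
have F0: 0 < #|F|.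
  have: 0 < #|F| * 2 ^ #|K| by apply: leq_trans FK; rewrite expn_gt0.
  by rewrite muln_gt0 => /andP[].
split=> //.
have l2: (0 < ln 2)%R by apply: (ln_INR_gt0 (q := 2)).
have := ln_INR_le _ FK; rewrite expn_gt0 => /(_ isT).
rewrite mult_INR !INR_expn ln_mult ?ln_pow; try apply: pow_lt;
  try (by apply: lt_0_INR; apply/ltP); try (by apply: (lt_0_INR 2); apply/ltP).
rewrite mult_INR -[INR 2]/2%R => H.
have mR: (0 < INR m)%R by apply: lt_0_INR; apply/ltP.
apply: (Rmult_le_reg_r (INR m * ln 2)); first exact: Rmult_lt_0_compat.
rewrite /Rdiv (Rmult_assoc (ln _)) Rinv_l; last by apply/Rgt_not_eq/Rmult_lt_0_compat.
have -> : ((INR #|V| - INR #|K| * / INR m) * (INR m * ln 2) =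
  INR m * INR #|V| * ln 2 - INR #|K| * ln 2)%R by field; apply: Rgt_not_eq.
rewrite Rmult_1_r; apply: (Rplus_le_reg_r (INR #|K| * ln 2)).
by rewrite Rplus_assoc Rplus_opp_l Rplus_0_r.
Qed.

(** * Codes, fixed points and guessing numbers *)

Lemma code_fixed_points n (e : rel 'I_n) (A : finType) (F : {set {ffun 'I_n -> A}}) :
  1 < #|A| -> code e F ->
  exists2 f : config n #|A| -> config n #|A|, IG_sub f e & #|F| <= nfix f.
Proof.
move=> A1 Fc; pose d : 'I_#|A| := Ordinal (ltnW A1).
pose g (x : {ffun 'I_n -> A}) : config n #|A| := [ffun v => enum_rank (x v)].
have ginj: injective g.
  by move=> x y xy; apply/ffunP=> v; apply: enum_rank_inj; have /ffunP/(_ v) := xy; rewrite !ffunE.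
(* Coordinate [v] decodes: any codeword that agrees with a given codeword on the neighbours of [v]
   has the same value at [v]; [d] is returned if no codeword agrees with the input. *)
exists (fun z => [ffun v =>
  if [pick x in F | agree (nbrs e v) (g x) z] is Some x then g x v else d]).
  move=> u v [a [b [ab]]]; rewrite !ffunE => neq; apply/negPn/negP => nuv; apply: neq.
  congr (if _ is Some x then g x v else d); apply: eq_pick => x /=; congr (_ && _).
  have H: agree (nbrs e v) a b.
    by apply/agreeP => w; rewrite inE => wv; apply: ab; apply: contraNneq nuv => <-.
  by apply/idP/idP => /agree_trans; apply; rewrite // agree_sym.
rewrite -(card_imset F ginj); apply/subset_leq_card/subsetP => _ /imsetP [x xF ->].
rewrite inE; apply/eqP/ffunP => v; rewrite ffunE.
case: pickP => [y /andP[yF /agreeP yx]|/(_ x)]; last by rewrite xF agree_refl.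
rewrite !ffunE; congr enum_rank; apply: Fc => // u uv.
by apply: enum_rank_inj; have := yx u; rewrite inE !ffunE; apply.
Qed.

(** [IG_sub] speaks of changes in a single coordinate; the coordinates where [a] and [b] differ are
    changed one at a time. *)
Lemma IG_sub_agree n q (e : rel 'I_n) (f : config n q -> config n q) :
  IG_sub f e -> forall v a b, agree (nbrs e v) a b -> f a v = f b v.
Proof.
move=> fe v a b; have [k] := ubnP #|[set u | a u != b u]|.
elim: k a => // k IH a dk ab.
have [u|eqab] := pickP [pred u | a u != b u]; last first.
  by congr (f _ v); apply/ffunP => u; apply/eqP/negPn; rewrite [_ != _]eqab.
rewrite inE => /= nu.
pose a' : config n q := [ffun w => if w == u then b u else a w].
have -> : f a v = f a' v.
  apply/eqP/negPn/negP => neq.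
  have /fe euv: depends f u v.
    by exists a, a'; split=> [w wu|]; [rewrite ffunE (negbTE wu) | apply/eqP].
  by move/agreeP: ab => /(_ u); rewrite inE => /(_ euv) /eqP; rewrite (negbTE nu).
apply: IH.
  rewrite -ltnS; apply: leq_trans dk; rewrite ltnS; apply: proper_card; apply/properP; split.
    by apply/subsetP => w; rewrite !inE ffunE; case: (w =P u) => [->|]; rewrite ?eqxx.
  by exists u; rewrite !inE ?ffunE ?eqxx.
apply/agreeP => w wv; rewrite ffunE; case: (w =P u) => [->//|_].
by move/agreeP: ab; apply.
Qed.

Lemma fixed_points_code n q (e : rel 'I_n) (f : config n q -> config n q) :
  IG_sub f e -> code e [set x | f x == x].
Proof.
move=> fe x y v; rewrite !inE => /eqP fx /eqP fy xy.
rewrite -fx -fy; apply: (IG_sub_agree fe); apply/agreeP => u; rewrite inE; exact: xy.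
Qed.

Lemma shannon_bound_ge0 (V : finType) (e : rel V) r : shannon_bound e r -> (0 <= r)%R.
Proof.
move=> /(_ (fun=> 0%R)); apply; split=> // *; lra.
Qed.

Lemma shannon_logfix n q (e : rel 'I_n) r (f : config n q -> config n q) :
  shannon_bound e r -> 1 < q -> IG_sub f e -> (logfix f <= r)%R.
Proof.
move=> er q1 fe; rewrite /logfix /nfix.
(* Without fixed points, [ln 0] is 0 by convention, and [r] is nonnegative because the zero function
   is a polymatroid. *)
have [->|F0] := posnP #|[set x | f x == x]|.
  have -> : ln (INR 0) = 0%R by rewrite /ln; case: Rlt_dec => // H; case: (Rlt_irrefl 0).
  by rewrite /Rdiv Rmult_0_l; apply: shannon_bound_ge0 er.
have A1 : 1 < #|'I_q| by rewrite card_ord.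
have [h eh] := code_polymatroid F0 A1 (fixed_points_code fe).
by rewrite card_ord => <-; apply: er.
Qed.

Lemma bounded_max (P : nat -> Prop) k0 b : P k0 -> (forall k, P k -> k <= b) ->
  exists2 k, P k & forall j, P j -> j <= k.
Proof.
move=> Pk0 Pb; have [d] := ubnP (b - k0); elim: d k0 Pk0 => // d IH k0 Pk0 dk.
have [[j [Pj k0j]]|no] := classic (exists j, P j /\ k0 < j); last first.
  by exists k0 => // j Pj; rewrite leqNgt; apply/negP => lt; apply: no; exists j.
apply: (IH j) => //; rewrite -ltnS; apply: leq_trans dk; rewrite ltnS ltn_sub2l //.
exact: leq_trans (Pb _ Pj).
Qed.

Lemma gn_ge n q (e : rel 'I_n) (f : config n q -> config n q) :
  1 < q -> IG_sub f e -> 0 < nfix f ->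
  exists2 r, is_gn e q r & (logfix f <= r)%R.
Proof.
move=> q1 fe f0.
have lq := ln_INR_gt0 q1.
have mono (g1 g2 : config n q -> config n q) : 0 < nfix g2 -> nfix g1 <= nfix g2 ->
    (logfix g1 <= logfix g2)%R.
  move=> g0 g12; apply: Rmult_le_compat_r; first by apply/Rlt_le/Rinv_0_lt_compat.
  have [E|g10] := posnP (nfix g1); last exact: ln_INR_le.
  have -> : ln (INR (nfix g1)) = ln (INR 1).
    by rewrite E ln_1 /ln; case: Rlt_dec => // H; case: (Rlt_irrefl 0).
  exact: ln_INR_le.
have [||k [g [ge gk]] kmax] := @bounded_max
   (fun k => exists g : config n q -> config n q, IG_sub g e /\ nfix g = k)
   (nfix f) #|{: config n q}|.
- by exists f.
- by move=> _ [g [_ <-]]; apply: max_card.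
have fg : nfix f <= nfix g by rewrite gk; apply: kmax; exists f.
exists (logfix g); last exact: mono (leq_trans f0 fg) fg.
split; first by exists g.
move=> g' g'e; apply: mono (leq_trans f0 fg) _.
by rewrite gk; apply: kmax; exists g'.
Qed.

Lemma clique_cover_gn n (e : rel 'I_n) r : clique_cover e r ->
  exists q r', [/\ 1 < q, is_gn e q r' & (r <= r')%R].
Proof.
move=> /clique_cover_code [A [A1 [F [Fc F0 rF]]]].
have [f fe Ff] := code_fixed_points A1 Fc.
have [r' gr' fr'] := gn_ge A1 fe (leq_trans F0 Ff).
exists #|A|, r'; split=> //; apply: Rle_trans rF _; apply: Rle_trans fr'.
apply: Rmult_le_compat_r; first by apply/Rlt_le/Rinv_0_lt_compat/ln_INR_gt0.
exact: ln_INR_le.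
Qed.

Lemma clique_cover_le_entropy n (e : rel 'I_n) r h :
  clique_cover e r -> is_entropy e h -> (r <= h)%R.
Proof.
move=> /clique_cover_gn [q [r' [q1 gr' rr']]] [ub _].
by apply: Rle_trans rr' _; apply: ub; exists q.
Qed.

Lemma entropy_le_shannon n (e : rel 'I_n) r h :
  shannon_bound e r -> is_entropy e h -> (h <= r)%R.
Proof.
move=> er [_ lub]; apply: lub => _ [q [q1 [[f [fe <-]] _]]].
exact: shannon_logfix er q1 fe.
Qed.

Lemma entropy_eq n (e : rel 'I_n) r :
  clique_cover e r -> shannon_bound e r -> is_entropy e r.
Proof.
move=> cr sr; split=> [_ [q [q1 [[f [fe <-]] _]]]|b ub]; first exact: shannon_logfix sr q1 fe.
have [q [r' [q1 gr' rr']]] := clique_cover_gn cr.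
by apply: Rle_trans rr' _; apply: ub; exists q.
Qed.

(** * Crowns *)

Lemma polymatroid_ge0 (V : finType) (e : rel V) h (A : {set V}) :
  polymatroid e h -> (0 <= h A)%R.
Proof. by case=> h0 mono _ _ _; rewrite -h0; apply: mono; apply: sub0set. Qed.

Lemma polymatroid_U_le (V : finType) (e : rel V) h (A B : {set V}) :
  polymatroid e h -> (h (A :|: B) <= h A + h B)%R.
Proof.
move=> ph; have := polymatroid_ge0 (A :&: B) ph; case: ph => _ _ /(_ A B) H _ _ H0; lra.
Qed.

Lemma polymatroid_card_le (V : finType) (e : rel V) h (A : {set V}) :
  polymatroid e h -> (h A <= INR #|A|)%R.
Proof.
move=> ph; have [k] := ubnP #|A|; elim: k A => // k IH A.
have [->|[a aA]] := set_0Vmem A.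
  by move=> _; rewrite cards0; case: ph => -> *; apply: Rle_refl.
rewrite (cardsD1 a) aA add1n ltnS S_INR => Ak.
have := IH _ Ak; have := polymatroid_U_le [set a] (A :\ a) ph; rewrite setD1K //.
case: ph => _ _ _ /(_ a) H _ H1 H2; lra.
Qed.

(** Submodularity for [A] and [v |: nbrs e v], whose intersection contains [nbrs e v]. *)
Lemma polymatroid_closure1 (V : finType) (e : rel V) h v (A : {set V}) :
  polymatroid e h -> nbrs e v \subset A -> (h (v |: A) <= h A)%R.
Proof.
case=> _ mono /(_ A (v |: nbrs e v)) sub _ /(_ v) cl NA.
have E : A :|: (v |: nbrs e v) = v |: A by rewrite setUCA (setUidPl NA).
have := mono (nbrs e v) (A :&: (v |: nbrs e v)); rewrite subsetI NA subsetU1 => /(_ isT).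
rewrite E in sub; lra.
Qed.

Lemma polymatroid_closure (V : finType) (e : rel V) h (I A : {set V}) :
  polymatroid e h -> (forall v, v \in I -> nbrs e v \subset A) -> (h (I :|: A) <= h A)%R.
Proof.
move=> ph; have [k] := ubnP #|I|; elim: k I => // k IH I.
have [->|[a aI]] := set_0Vmem I; first by rewrite set0U => *; apply: Rle_refl.
rewrite (cardsD1 a) aI add1n ltnS => Ik NI.
have IA : forall v, v \in I :\ a -> nbrs e v \subset A.
  by move=> v /setD1P [_ vI]; apply: NI.
apply: Rle_trans (IH _ Ik IA).
rewrite -{1}(setD1K aI) -setUA; apply: polymatroid_closure1 ph _.
by apply: subset_trans (NI _ aI) _; apply: subsetUr.
Qed.

Definition sub_rel (V : finType) (e : rel V) (C : {set V}) : rel {v | v \notin C} :=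
  fun u v => e (val u) (val v).

(** Conditioning on [C]: a neighbour of a surviving vertex lies in [C] or survives itself, so the
    closure clause is inherited. *)
Lemma contraction (V : finType) (e : rel V) (C : {set V}) h :
  polymatroid e h ->
  polymatroid (@sub_rel V e C) (fun X => (h (C :|: val @: X) - h C)%R).
Proof.
move=> ph; have [h0 mono sub unit cl] := ph; split.
- by rewrite imset0 setU0; ring.
- by move=> A B AB; apply/Rplus_le_compat_r/mono/setUS/imsetS.
- move=> A B; rewrite imsetU imsetI; last by move=> ? ? _ _; apply: val_inj.
  have shift (a b c d x : R) : (a + b <= c + d -> (a - x) + (b - x) <= (c - x) + (d - x))%R by lra.
  by apply: shift; have := sub (C :|: val @: A) (C :|: val @: B); rewrite setUACA setUid -setUIr.
- move=> v; rewrite imset_set1.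
  have := polymatroid_U_le C [set val v] ph; have := unit (val v); lra.
- move=> v; apply: Rplus_le_compat_r; rewrite imsetU imset_set1 setUCA.
  apply: polymatroid_closure1 ph _; apply/subsetP => u; rewrite !inE => uv.
  have [//|uC] := boolP (u \in C); apply/imsetP; exists (exist _ u uC) => //.
  by rewrite inE.
Qed.

(** [I] is determined by [S], so [I :|: S] has rank at most [#|S|]; the contraction bounds the
    rest. *)
Lemma crown_shannon (V : finType) (e : rel V) (S I : {set V}) r :
  (forall v, v \in I -> nbrs e v \subset S) ->
  shannon_bound (@sub_rel V e (I :|: S)) r -> shannon_bound e (r + INR #|S|)%R.
Proof.
move=> NI sr h ph; have := sr _ (contraction (I :|: S) ph).
have -> : I :|: S :|: val @: [set: {v | v \notin I :|: S}] = setT.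
  apply/setP => v; rewrite in_setT in_setU; case: (boolP (v \in I :|: S)) => //= vC.
  by apply/imsetP; exists (exist _ v vC); rewrite ?inE.
have := polymatroid_closure ph NI; have := polymatroid_card_le S ph; lra.
Qed.

(** Each vertex of [I] opens [m] new cliques, and [s] in [S] joins those of its partner [g s]. This
    adds [#|I| + #|S|] vertices at cost [#|I|]. *)
Lemma crown_cover (V : finType) (e : rel V) (S I : {set V}) (g : V -> V) r :
  (forall u v, e u v = e v u) -> [disjoint I & S] -> I != set0 ->
  {in S &, injective g} -> (forall s, s \in S -> g s \in I /\ e (g s) s) ->
  clique_cover (@sub_rel V e (I :|: S)) r -> clique_cover e (r + INR #|S|)%R.
Proof.
move=> esym dis /set0Pn [i0 i0I] ginj gI [m [K [t [m0 tinj tclq ->]]]].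
(* [i1] is the default of [insubd], never reached on [I :|: S] because [k] maps that set into
   [I]. *)
pose i1 : {v | v \in I} := exist _ i0 i0I.
pose k v := if v \in I then v else g v.
have kI v : v \in I :|: S -> k v \in I.
  by rewrite inE /k; case: ifP => // _ /gI [].
pose T v j : K + {v | v \in I} * 'I_m :=
  if insub v is Some v' then inl (t v' j) else inr (insubd i1 (k v), j).
have Tin v j (vC : v \notin I :|: S) : T v j = inl (t (exist _ v vC) j).
  by rewrite /T insubT.
have Tout v j : v \in I :|: S -> T v j = inr (insubd i1 (k v), j).
  by move=> vC; rewrite /T insubF ?vC.
exists m, (K + {v | v \in I} * 'I_m)%type, T; split=> //.
- move=> v i j; case: (boolP (v \in I :|: S)) => vC; first by rewrite !Tout // => -[].
  by rewrite !(Tin _ _ vC) => -[/tinj].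
- move=> u v i j; case: (boolP (u \in I :|: S)) => uC; case: (boolP (v \in I :|: S)) => vC.
  + rewrite !Tout // => -[/(congr1 val)]; rewrite !val_insubd !kI // => + _.
    move: uC vC; rewrite !inE /k; case: ifP => uI; case: ifP => vI /= uS vS.
    * by left.
    * by move=> ->; right; case: (gI v vS).
    * by move=> <-; right; rewrite esym; case: (gI u uS).
    * by left; apply: ginj.
  + by rewrite Tout // (Tin _ _ vC).
  + by rewrite (Tin _ _ uC) Tout.
  + by rewrite (Tin _ _ uC) (Tin _ _ vC) => -[/tclq [/(congr1 val)|]]; [left | right].
- have mR: INR m <> 0%R by apply/Rgt_not_eq/lt_0_INR/ltP.
  rewrite card_sum card_prod card_ord !card_sig.
  have -> : #|[pred v | v \notin I :|: S]| = #|~: (I :|: S)|.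
    by apply: eq_card => v; rewrite !inE.
  have -> : #|[pred v | v \in I]| = #|I| by apply: eq_card.
  rewrite plus_INR mult_INR -(cardsC (I :|: S)) cardsU (disjoint_setI0 dis) cards0 subn0.
  by rewrite !plus_INR; field.
Qed.

(** * Hall's theorem *)

Definition nbhd (V : finType) (e : rel V) (X : {set V}) : {set V} :=
  \bigcup_(x in X) nbrs e x.

Lemma nbhdU (V : finType) (e : rel V) (X Y : {set V}) :
  nbhd e (X :|: Y) = nbhd e X :|: nbhd e Y.
Proof. exact: bigcup_setU. Qed.

Lemma nbhdS (V : finType) (e : rel V) (X Y : {set V}) :
  X \subset Y -> nbhd e X \subset nbhd e Y.
Proof. by move=> /setUidPr <-; rewrite nbhdU subsetUl. Qed.

Lemma nbhdP (V : finType) (e : rel V) (X : {set V}) u :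
  reflect (exists2 x, x \in X & e u x) (u \in nbhd e X).
Proof. by apply: (iffP bigcupP) => -[x xX]; rewrite ?inE => ux; exists x; rewrite ?inE. Qed.

(** Induction on [#|A|]. A nonempty proper tight set [X] splits the problem into [X] and [A :\: X],
    the latter with targets outside [nbhd e X]; if there is none, every such set has a neighbour to
    spare and any one pair can be matched first. *)
Lemma hall_in (V : finType) (e : rel V) (A B : {set V}) :
  (forall X : {set V}, X \subset A -> #|X| <= #|nbhd e X :&: B|) ->
  exists f : V -> V, {in A &, injective f} /\
    forall x, x \in A -> f x \in B /\ e (f x) x.
Proof.
have [k] := ubnP #|A|; elim: k A B => // k IH A B Ak hall.
have [[X /and3P[X0 XA tight]]|notight] := altP (@existsP {set V}
    (fun X => [&& X != set0, X \proper A & #|nbhd e X :&: B| == #|X|])).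
- have [|Y YX|f [finj fX]] := IH X B.
  + exact: leq_trans (proper_card XA) _.
  + by apply: hall; apply: subset_trans YX (proper_sub XA).
  have [|Y YA|g [ginj gX]] := IH (A :\: X) (B :\: nbhd e X).
  + rewrite -ltnS; apply: leq_trans Ak; rewrite ltnS -(cardsID X A).
    by rewrite (setIidPr (proper_sub XA)) -[ltnLHS]add0n ltn_add2r card_gt0.
  + have YX : [disjoint X & Y].
      rewrite -setI_eq0; apply/eqP/setP => v; rewrite !inE; apply/negP => /andP[vX vY].
      by move/subsetP/(_ _ vY): YA; rewrite inE vX.
    have := hall (X :|: Y); rewrite subUset (proper_sub XA) (subset_trans YA (subsetDl _ _)).
    rewrite cardsU (disjoint_setI0 YX) cards0 subn0 nbhdU => /(_ isT) H.
    rewrite -(leq_add2l #|X|); apply: leq_trans H _.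
    rewrite -[X in _ <= X + _](eqP tight); apply: leq_trans (leq_card_setU _ _).
    apply: subset_leq_card; apply/subsetP => v; rewrite !inE.
    by case: (v \in nbhd e X) => //=; case: (v \in B); rewrite ?andbF // ?andbT.
  exists (fun x => if x \in X then f x else g x); split=> [x y xA yA|x xA]; last first.
    case: ifP => xX; first exact: fX.
    have [|gB ge] := gX x; first by rewrite inE xX.
    by split=> //; move: gB; rewrite inE => /andP[].
  have nbf z : z \in X -> f z \in nbhd e X.
    by move=> zX; apply/nbhdP; exists z; case: (fX z zX).
  have nbg z : z \in A -> z \notin X -> g z \notin nbhd e X.
    by move=> zA zX; have [|] := gX z; [rewrite inE zX | rewrite inE => /andP[]].
  case: ifPn => xX; case: ifPn => yX; first exact: finj.
  + by move=> E; have := nbf x xX; rewrite E (negbTE (nbg y yA yX)).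
  + by move=> E; have := nbf y yX; rewrite -E (negbTE (nbg x xA xX)).
  + by apply: ginj; rewrite inE ?xX ?yX.
- have [->|[a aA]] := set_0Vmem A; first by exists (fun x => x); split=> x; rewrite inE.
  have := hall [set a]; rewrite sub1set aA cards1 => /(_ isT).
  move=> /card_gt0P [b /setIP [/nbhdP [_ /set1P -> ba] bB]].
  have [|Y YA|f [finj fA]] := IH (A :\ a) (B :\ b).
  + by move: Ak; rewrite (cardsD1 a) aA.
  + have [->|Y0] := eqVneq Y set0; first by rewrite cards0.
    have YpA : Y \proper A.
      apply/properP; split; first exact: subset_trans YA (subsetDl _ _).
      by exists a => //; apply/negP => /(subsetP YA); rewrite !inE eqxx.
    move: notight; rewrite negb_exists => /forallP /(_ Y); rewrite Y0 YpA /=.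
    move=> neq; have := hall Y (proper_sub YpA); rewrite leq_eqVlt eq_sym (negbTE neq) /=.
    rewrite setIDA [X in _ < X](cardsD1 b) => /leq_trans lt.
    rewrite -ltnS; apply: (lt (1 + #|(nbhd e Y :&: B) :\ b|)).
    by rewrite leq_add2r leq_b1.
  exists (fun x => if x == a then b else f x); split=> [x y xA yA|x xA]; last first.
    case: eqP => [->//|/eqP xa].
    have [|fB fe] := fA x; first by rewrite !inE xa.
    by split=> //; move: fB; rewrite inE => /andP[].
  have fb z : z \in A -> z != a -> f z != b.
    by move=> zA za; have [|] := fA z; [rewrite !inE za | rewrite !inE => /andP[]].
  case: eqP => [->|/eqP xa]; case: eqP => [->//|/eqP ya].
  + by move=> E; have := fb y yA ya; rewrite -E eqxx.
  + by move=> E; have := fb x xA xa; rewrite E eqxx.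
  + by apply: finj; rewrite !inE ?xa ?ya.
Qed.

Lemma hall (V : finType) (e : rel V) (A : {set V}) :
  (forall X : {set V}, X \subset A -> #|X| <= #|nbhd e X|) ->
  exists f : V -> V, {in A &, injective f} /\ forall x, x \in A -> e (f x) x.
Proof.
move=> H; have [|f [finj fA]] := @hall_in V e A setT.
  by move=> X XA; rewrite setIT; apply: H.
by exists f; split=> // x /fA [].
Qed.

(** * Patterns on labelled vertices *)

Definition simple (V : finType) (e : rel V) : Prop :=
  (forall u v, e u v = e v u) /\ (forall u, e u u = false).

Definition low_value (r : R) : Prop :=
  (r = 0 \/ r = 1 \/ r = 2 \/ r = 5/2 \/ r = 3 \/ r = 7/2 \/ r = 11/3)%R.

(** Phrased with the two bounds instead of the entropy, because both bounds shift by [#|S|] when a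
    crown is removed. *)
Definition settled (V : finType) (e : rel V) : Prop :=
  exists2 r, clique_cover e r & (4 <= r)%R \/ low_value r /\ shannon_bound e r.

Definition labelling (V : finType) (n : nat) (g : nat -> V) : Prop :=
  {in [pred i | i < n] &, injective g} /\ forall v, exists2 i, i < n & g i = v.

(* Conditionals rather than boolean connectives, so that call-by-value
   evaluation stops at the first decisive element. *)
Fixpoint allb (T : Type) (a : pred T) (s : seq T) : bool :=
  if s is x :: s' then if a x then allb a s' else false else true.

Fixpoint hasb (T : Type) (a : pred T) (s : seq T) : bool :=
  if s is x :: s' then if a x then true else hasb a s' else false.

Lemma allbE (T : Type) (a : pred T) s : allb a s = all a s.
Proof. by elim: s => //= x s ->; case: (a x). Qed.

Lemma hasbE (T : Type) (a : pred T) s : hasb a s = has a s.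
Proof. by elim: s => //= x s ->; case: (a x). Qed.

Definition adj (L : seq (nat * nat)) (i j : nat) : bool :=
  hasb (fun p => ((p.1 == i) && (p.2 == j)) || ((p.1 == j) && (p.2 == i))) L.

Lemma adjP L i j : reflect ((i, j) \in L \/ (j, i) \in L) (adj L i j).
Proof.
rewrite /adj hasbE; apply: (iffP hasP) => [[[a b] pL /= /orP[] /andP[/eqP <- /eqP <-]]|].
- by left.
- by right.
- by case=> pL; [exists (i, j) | exists (j, i)]; rewrite //= !eqxx ?orbT.
Qed.

(** Pairs in neither list are unconstrained, so a pattern describes all graphs between [P] and the
    complement of [N]. *)
Definition fits (V : finType) (e : rel V) (g : nat -> V) (P N : seq (nat * nat)) : Prop :=
  (forall p, p \in P -> e (g p.1) (g p.2)) /\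
  (forall p, p \in N -> ~~ e (g p.1) (g p.2)).

Lemma fits_adj (V : finType) (e : rel V) g P N i j : (forall u v, e u v = e v u) ->
  fits e g P N -> adj P i j -> e (g i) (g j).
Proof. by move=> esym [eP _] /adjP [] /eP //; rewrite esym. Qed.

Lemma fits_nadj (V : finType) (e : rel V) g P N i j : (forall u v, e u v = e v u) ->
  fits e g P N -> adj N i j -> ~~ e (g i) (g j).
Proof. by move=> esym [_ eN] /adjP [] /eN //; rewrite esym. Qed.

(** Row [i] of [T] lists the [m] cliques, numbered below [k], that contain label [i]. *)
Definition cover_table (n m k : nat) (P : seq (nat * nat)) (T : seq (seq nat)) : bool :=
  all (fun i => let row := nth [::] T i in
    [&& size row == m, uniq row, all (fun c => c < k) row &
        all (fun j => [|| i == j, adj P i j | ~~ has (mem row) (nth [::] T j)]) (iota 0 n)])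
    (iota 0 n).

Lemma table_clique_cover (V : finType) (e : rel V) n m k P N T g :
  (forall u v, e u v = e v u) -> labelling n g -> fits e g P N ->
  0 < m -> cover_table n m k P T -> clique_cover e (INR n - INR k / INR m).
Proof.
move=> esym [ginj gsurj] eP m0 /allP ok.
pose idx v := find (fun i => g i == v) (iota 0 n).
have idxP v : idx v < n /\ g (idx v) = v.
  have H: has (fun i => g i == v) (iota 0 n).
    by have [i ni <-] := gsurj v; apply/hasP; exists i; rewrite ?mem_iota.
  have lt: idx v < n by rewrite -[n](size_iota 0) -has_find.
  by split=> //; apply/eqP; have := nth_find 0 H; rewrite nth_iota.
have rowP v : idx v \in iota 0 n by rewrite mem_iota; case: (idxP v).
pose row v := nth [::] T (idx v).
have rsize v : size (row v) = m by apply/eqP; have /and4P[] := ok _ (rowP v).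
have rlt v (j : 'I_m) : nth 0 (row v) j < k.
  have /and4P[_ _ /allP H _] := ok _ (rowP v).
  by apply: H; rewrite mem_nth // -/(row v) rsize.
exists m, 'I_k, (fun v j => Ordinal (rlt v j)); split=> //.
- move=> v i j [] /eqP; rewrite nth_uniq ?rsize //; first by move/eqP/val_inj.
  by have /and4P[] := ok _ (rowP v).
- move=> u v i j [] E.
  have /and4P[_ _ _ /allP /(_ _ (rowP v)) /or3P[]] := ok _ (rowP u).
  + by move/eqP => uv; left; rewrite -(idxP u).2 uv (idxP v).2.
  + by move=> /(fits_adj esym eP); rewrite !(idxP _).2; right.
  + case/negP; apply/hasP; exists (nth 0 (row v) j); first by rewrite -/(row v) mem_nth ?rsize.
    by rewrite /= -E mem_nth // -/(row u) rsize.
- rewrite card_ord; congr (INR _ - _)%R.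
  have inj: injective (fun i : 'I_n => g i).
    by move=> i j /ginj H; apply/val_inj/H; rewrite inE ltn_ord.
  rewrite -[LHS]card_ord -(card_codom inj); apply: eq_card => v.
  apply/idP; have [lt gi] := idxP v; apply/codomP.
  by exists (Ordinal lt).
Qed.

(** Every pair outside [N] counts as a possible edge, so a label enters only when all its potential
    neighbours are present; the step is then valid in every graph that fits the pattern. *)
Definition closure1 (n : nat) (N : seq (nat * nat)) (X : seq nat) : seq nat :=
  X ++ [seq i <- iota 0 n | all (fun j => [|| j == i, adj N j i | j \in X]) (iota 0 n)].

(** Combines submodularity with closure on the side of the union and monotonicity on both sides. *)
Definition submod_check (n : nat) (N : seq (nat * nat)) (A B C D : seq nat) : bool :=
  all (mem (iter n (closure1 n N) (A ++ B))) C && all (fun i => (i \in A) && (i \in B)) D.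

(* [H A] plays the role of the rank of the set of vertices with labels in [A]. *)
Definition label_bound (n : nat) (N : seq (nat * nat)) (r : R) : Prop :=
  forall H : seq nat -> R, H [::] = 0%R -> (forall i, (H [:: i] <= 1)%R) ->
  (forall A B C D, submod_check n N A B C D -> (H C + H D <= H A + H B)%R) ->
  (H (iota 0 n) <= r)%R.

Lemma label_shannon_bound (V : finType) (e : rel V) n P N g r :
  simple e -> labelling n g -> fits e g P N -> label_bound n N r -> shannon_bound e r.
Proof.
move=> [esym eirr] [_ gsurj] eN bound h ph.
have [h0 mono sub unit _] := ph.
pose S (A : seq nat) : {set V} := [set v in map g A].
have SP A i : i \in A -> g i \in S A by move=> iA; rewrite inE map_f.
have SS (A B : seq nat) : {subset A <= B} -> S A \subset S B.
  by move=> AB; apply/subsetP => v; rewrite !inE => /mapP [i /AB iB ->]; apply: map_f.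
have SU A B : S (A ++ B) = S A :|: S B by apply/setP => v; rewrite !inE map_cat mem_cat.
have cl A : (h (S (closure1 n N A)) <= h (S A))%R.
  rewrite /closure1 SU setUC; apply: polymatroid_closure ph _ => v.
  rewrite inE => /mapP [i]; rewrite mem_filter => /andP[/allP iN _] ->.
  apply/subsetP => u; rewrite inE; have [j jn <-] := gsurj u => eji.
  have /or3P[/eqP ji|Nji|jA] : [|| j == i, adj N j i | j \in A] by apply: iN; rewrite mem_iota.
  - by move: eji; rewrite ji eirr.
  - by move: eji; rewrite (negbTE (fits_nadj esym eN Nji)).
  - exact: SP.
have cln k A : (h (S (iter k (closure1 n N) A)) <= h (S A))%R.
  elim: k => [|k IH]; first exact: Rle_refl.
  by apply: Rle_trans IH; apply: cl.
apply: (Rle_trans _ (h (S (iota 0 n)))).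
  apply/mono/subsetP => v _; have [i ni <-] := gsurj v.
  by apply: SP; rewrite mem_iota.
apply: (bound (fun A => h (S A))).
- by rewrite -h0; congr h; apply/setP => v; rewrite !inE.
- move=> i; have -> : S [:: i] = [set g i] by apply/setP => v; rewrite !inE.
  exact: unit.
- move=> A B C D /andP [/allP CAB /allP DAB].
  have hC : (h (S C) <= h (S A :|: S B))%R.
    by apply: Rle_trans (mono _ _ (SS _ _ CAB)) _; rewrite -SU; apply: cln.
  have hD : (h (S D) <= h (S A :&: S B))%R.
    by apply: mono; rewrite subsetI !SS // => i /DAB /andP[].
  have := sub (S A) (S B); lra.
Qed.

Definition settling (n : nat) (P N : seq (nat * nat)) (r : R) : Prop :=
  forall (V : finType) (e : rel V) g, simple e -> labelling n g -> fits e g P N ->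
  clique_cover e r /\ ((4 <= r)%R \/ low_value r /\ shannon_bound e r).

Lemma settling_settled (V : finType) (e : rel V) n P N r g : settling n P N r ->
  simple e -> labelling n g -> fits e g P N -> settled e.
Proof. by move=> sP es gl eP; have [] := sP V e g es gl eP; exists r. Qed.

Lemma settling_high n m k P T r :
  0 < m -> cover_table n m k P T -> r = (INR n - INR k / INR m)%R ->
  (4 <= r)%R -> settling n P [::] r.
Proof.
move=> m0 ok -> r4 V e g [esym _] gl eP.
by split; [apply: table_clique_cover eP m0 ok | left].
Qed.

Lemma settling_low n m k P N T r :
  0 < m -> cover_table n m k P T -> r = (INR n - INR k / INR m)%R ->
  low_value r -> label_bound n N r -> settling n P N r.
Proof.
move=> m0 ok rE rl bound V e g es gl eP; split.
  by rewrite rE; apply: table_clique_cover es.1 gl eP m0 ok.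
by right; split=> //; apply: label_shannon_bound es gl eP bound.
Qed.

Lemma labelling_perm (V : finType) n g s : @labelling V n g -> perm_eq s (iota 0 n) ->
  labelling n (fun i => g (nth 0 s i)).
Proof.
move=> [ginj gsurj] sn.
have ss : size s = n by rewrite (perm_size sn) size_iota.
have lt i : i < n -> nth 0 s i < n.
  by move=> ni; have := mem_nth 0 (_ : i < size s); rewrite ss (perm_mem sn) mem_iota => /(_ ni).
split=> [i j ni nj /ginj|v].
  rewrite !inE !lt // => /(_ isT isT) /eqP; rewrite nth_uniq ?ss // => [/eqP //|].
  by rewrite (perm_uniq sn) iota_uniq.
have [i ni <-] := gsurj v; exists (index i s).
  by rewrite -ss index_mem (perm_mem sn) mem_iota.
by rewrite nth_index // (perm_mem sn) mem_iota.
Qed.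

(* [(ss, (P, N))] stands for the pattern with edges [P] and non-edges [N], tried
   under each of the relabellings [ss]. *)
Definition item := (seq (seq nat) * (seq (nat * nat) * seq (nat * nat)))%type.

(** [acc] holds the sure edges and [all] the pairs not yet excluded, so a match is valid for every
    completion of the current branch. *)
Definition matches (acc all : seq (nat * nat)) (it : item) : bool :=
  hasb (fun s =>
    if allb (fun p => adj acc (nth 0 s p.1) (nth 0 s p.2)) it.2.1
    then allb (fun p => ~~ adj all (nth 0 s p.1) (nth 0 s p.2)) it.2.2
    else false) it.1.

(* Branches on the pairs of [rest] one by one; [acc] lists the pairs decided to be edges. *)
Fixpoint search (items : seq item) (acc rest : seq (nat * nat)) : bool :=
  if hasb (matches acc (acc ++ rest)) items then true
  else if rest is p :: rest' then
    if search items (p :: acc) rest' then search items acc rest' else false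
  else false.

(** Invariant of the branching: the edge set lies between [acc] and [acc ++ rest]. A pair decided to
    be a non-edge is dropped from both. *)
Lemma search_settled (V : finType) (e : rel V) n g
    (items : seq item) (acc rest : seq (nat * nat)) :
  simple e -> labelling n g ->
  (forall it, it \in items -> {subset it.1 <= permutations (iota 0 n)} /\
     exists r, settling n it.2.1 it.2.2 r) ->
  (forall p, p \in acc -> e (g p.1) (g p.2)) ->
  (forall i j, i < n -> j < n -> e (g i) (g j) -> adj (acc ++ rest) i j) ->
  search items acc rest -> settled e.
Proof.
move=> es gl itP.
have nth_lt s i : perm_eq s (iota 0 n) -> nth 0 s i < n.
  (* The label of the vertex [g 0] shows that [n] is positive, so the default 0 of [nth] is a legal
     label too. *)
  move=> sn; have [j jn _] := gl.2 (g 0); have [lt|le] := ltnP i (size s).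
    by have := mem_nth 0 lt; rewrite (perm_mem sn) mem_iota.
  by rewrite nth_default // (leq_trans _ jn).
elim: rest acc => [|p rest IH] acc eacc eall /=;
  rewrite hasbE; case: ifP => [/hasP [it itin]|_] //.
1,2: rewrite /matches hasbE => /hasP [s /(itP _ itin).1]; rewrite mem_permutations => sn.
1,2: case: ifP => //; rewrite !allbE => /allP sP /allP sN _.
1,2: have [r sr] := (itP _ itin).2.
1,2: apply: (settling_settled sr es (labelling_perm gl sn)); split=> q qin.
1,3: by case/adjP: (sP _ qin) => /eacc //=; rewrite es.1.
1,2: by apply/negP => eq; case/negP: (sN _ qin); apply: eall eq; apply: nth_lt.
case: ifP => // accp nacc.
have [ep|np] := boolP (e (g p.1) (g p.2)).
  apply: (IH (p :: acc)) => //.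
    by move=> q; rewrite inE => /predU1P [->|/eacc].
  move=> i j ni nj /(eall i j ni nj) /adjP H; apply/adjP.
  by move: H; rewrite !(mem_cat, inE) /= => H; case: H => /or3P[] ->; rewrite ?orbT; auto.
apply: (IH acc) => // i j ni nj eij; have := eall i j ni nj eij.
move=> /adjP H; apply/adjP; move: H; rewrite !mem_cat !inE.
case=> /or3P[] H; rewrite ?H ?orbT; auto.
  by move: np; rewrite -(eqP H) eij.
by move: np; rewrite -(eqP H) es.1 eij.
Qed.

(** * The patterns on at most seven vertices *)

Definition pairs (n : nat) : seq (nat * nat) :=
  [seq (i, j) | j <- iota 0 n, i <- iota 0 j].

Definition others (n : nat) (L : seq (nat * nat)) : seq (nat * nat) :=
  [seq p <- pairs n | ~~ adj L p.1 p.2].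

Definition cycle_pairs (n : nat) : seq (nat * nat) :=
  [seq (i, i.+1 %% n) | i <- iota 0 n].

(** Every list of permutations is sound; the filter trims the search to those carrying [X] into
    [B]. *)
Definition placements (n : nat) (X B : seq (nat * nat)) : seq (seq nat) :=
  [seq s <- permutations (iota 0 n)
     | allb (fun p => adj B (nth 0 s p.1) (nth 0 s p.2)) X].

(* Keeps one placement per orbit of a pattern invariant under permuting the
   positions of each of the lists in [ls]. *)
Definition sorted_placements (n : nat) (ls : seq (seq nat)) : seq (seq nat) :=
  [seq s <- permutations (iota 0 n)
     | allb (fun l => sorted ltn [seq nth 0 s i | i <- l]) ls].

(** Here and in every pattern below that has value less than 4 and is covered by disjoint cliques,
    the upper bound is [n] minus the size of an independent set, which its complement determines. *)
Lemma settling_K2 : settling 2 (pairs 2) [::] 1.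
Proof.
apply: (@settling_low 2 1 1 _ _ [:: [:: 0]; [:: 0]]) => //=.
- by lra.
- by rewrite /low_value; lra.
move=> H H0 H1 sub.
have := sub [:: 0] [::] [:: 0; 1] [::] isT; have := H1 0; rewrite /= H0; lra.
Qed.

Lemma settling_K3 : settling 3 (pairs 3) [::] 2.
Proof.
apply: (@settling_low 3 1 1 _ _ (nseq 3 [:: 0])) => //=.
- by lra.
- by rewrite /low_value; lra.
move=> H H0 H1 sub; have := sub [:: 0] [:: 1] [:: 0; 1; 2] [::] isT.
have := H1 0; have := H1 1; rewrite /= H0; lra.
Qed.

Lemma settling_K4 : settling 4 (pairs 4) [::] 3.
Proof.
apply: (@settling_low 4 1 1 _ _ (nseq 4 [:: 0])) => //=.
- by lra.
- by rewrite /low_value; lra.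
move=> H H0 H1 sub; have := sub [:: 0] [:: 1] [:: 0; 1] [::] isT.
have := sub [:: 0; 1] [:: 2] [:: 0; 1; 2; 3] [::] isT.
have := H1 0; have := H1 1; have := H1 2; rewrite /= H0; lra.
Qed.

Definition matching4 : seq (nat * nat) := [:: (0, 1); (2, 3)].

(** A graph on four vertices with this matching, other than the complete one, misses a pair across
    the two edges, which relabelling moves to [(0, 2)]. *)
Lemma settling_2K2 : settling 4 matching4 [:: (0, 2)] 2.
Proof.
apply: (@settling_low 4 1 2 _ _ [:: [:: 0]; [:: 0]; [:: 1]; [:: 1]]) => //=.
- by lra.
- by rewrite /low_value; lra.
move=> H H0 H1 sub; have := sub [:: 1] [:: 3] [:: 0; 1; 2; 3] [::] isT.
have := H1 1; have := H1 3; rewrite /= H0; lra.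
Qed.

Lemma settling_K5 : settling 5 (pairs 5) [::] 4.
Proof. by apply: (@settling_high 5 1 1 _ (nseq 5 [:: 0])) => //=; lra. Qed.

Definition triangle_edge : seq (nat * nat) := [:: (0, 1); (0, 2); (1, 2); (3, 4)].

Lemma settling_triangle_edge : settling 5 triangle_edge [:: (0, 3)] 3.
Proof.
apply: (@settling_low 5 1 2 _ _ [:: [:: 0]; [:: 0]; [:: 0]; [:: 1]; [:: 1]]) => //=.
- by lra.
- by rewrite /low_value; lra.
move=> H H0 H1 sub; have := sub [:: 1] [:: 2] [:: 1; 2] [::] isT.
have := sub [:: 1; 2] [:: 4] [:: 0; 1; 2; 3; 4] [::] isT.
have := H1 1; have := H1 2; have := H1 4; rewrite /= H0; lra.
Qed.

(* The submodular inequalities listed here and below were read off optimal dual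
   solutions of the linear program maximizing the rank of the whole vertex set. *)
Lemma settling_C5 : settling 5 (cycle_pairs 5) (others 5 (cycle_pairs 5)) (5 / 2).
Proof.
apply: (@settling_low 5 2 5 _ _
  [:: [:: 0; 4]; [:: 0; 1]; [:: 1; 2]; [:: 2; 3]; [:: 3; 4]]) => //=.
- by lra.
- by rewrite /low_value; lra.
move=> H H0 H1 sub.
have := sub [:: 2] [:: 0] [:: 0; 1; 2] [::] isT.
have := sub [:: 3] [:: 0] [:: 0; 3; 4] [::] isT.
have := sub [:: 4] [:: 1] [:: 0; 1; 4] [::] isT.
have := sub [:: 0; 3; 4] [:: 0; 1] [:: 0; 1; 2; 3; 4] [:: 0] isT.
have := sub [:: 0; 1; 4] [:: 0; 1; 2] [:: 0; 1; 2; 3; 4] [:: 0; 1] isT.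
have := H1 0; have := H1 1; have := H1 2; have := H1 3; have := H1 4.
rewrite /= H0; lra.
Qed.

Lemma settling_2K3 :
  settling 6 [:: (0, 1); (0, 2); (1, 2); (3, 4); (3, 5); (4, 5)] [::] 4.
Proof.
apply: (@settling_high 6 1 2 _ [:: [:: 0]; [:: 0]; [:: 0]; [:: 1]; [:: 1]; [:: 1]]) => //=; lra.
Qed.

Lemma settling_K4_edge : settling 6 (pairs 4 ++ [:: (4, 5)]) [::] 4.
Proof.
apply: (@settling_high 6 1 2 _ [:: [:: 0]; [:: 0]; [:: 0]; [:: 0]; [:: 1]; [:: 1]]) => //=; lra.
Qed.

Definition matching6 : seq (nat * nat) := [:: (0, 1); (2, 3); (4, 5)].

Lemma settling_3K2 : settling 6 matching6 [:: (0, 2); (0, 4); (2, 4)] 3.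
Proof.
apply: (@settling_low 6 1 3 _ _ [:: [:: 0]; [:: 0]; [:: 1]; [:: 1]; [:: 2]; [:: 2]]) => //=.
- by lra.
- by rewrite /low_value; lra.
move=> H H0 H1 sub; have := sub [:: 1] [:: 3] [:: 1; 3] [::] isT.
have := sub [:: 1; 3] [:: 5] [:: 0; 1; 2; 3; 4; 5] [::] isT.
have := H1 1; have := H1 3; have := H1 5; rewrite /= H0; lra.
Qed.

Definition hub_C5 : seq (nat * nat) := cycle_pairs 5 ++ [:: (5, 0); (5, 1); (5, 2)].

(** In the cover, label 5 enlarges the cycle edges [(0, 1)] and [(1, 2)] to triangles. Its pairs
    with 3 and 4 are free, so the upper bound has to hold up to the wheel on the 5-cycle. *)
Lemma settling_hub_C5 : settling 6 hub_C5 (others 5 (cycle_pairs 5)) (7 / 2).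
Proof.
apply: (@settling_low 6 2 5 _ _
  [:: [:: 0; 4]; [:: 0; 1]; [:: 1; 2]; [:: 2; 3]; [:: 3; 4]; [:: 0; 1]]) => //=.
- by lra.
- by rewrite /low_value; lra.
move=> H H0 H1 sub.
have := sub [:: 3] [:: 0] [:: 0; 3] [::] isT.
have := sub [:: 3] [:: 1] [:: 1; 3] [::] isT.
have := sub [:: 5] [:: 2] [:: 2; 5] [::] isT.
have := sub [:: 5] [:: 3] [:: 3; 5] [::] isT.
have := sub [:: 5] [:: 4] [:: 4; 5] [::] isT.
have := sub [:: 3; 4] [:: 1; 3] [:: 1; 3; 4] [:: 3] isT.
have := sub [:: 4] [:: 3] [:: 3; 4] [::] isT.
have := sub [:: 3; 5] [:: 0; 3] [:: 0; 3; 4; 5] [:: 3] isT.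
have := sub [:: 3; 4; 5] [:: 1; 3; 4] [:: 0; 1; 2; 3; 4; 5] [:: 3; 4] isT.
have := sub [:: 4; 5] [:: 2; 5] [:: 2; 3; 4; 5] [:: 5] isT.
have := sub [:: 2; 3; 4; 5] [:: 0; 3; 4; 5] [:: 0; 1; 2; 3; 4; 5] [:: 3; 4; 5] isT.
have := H1 0; have := H1 1; have := H1 2; have := H1 3; have := H1 4; have := H1 5.
rewrite /= H0; lra.
Qed.

Lemma settling_K3_2K2 : settling 7 [:: (0, 1); (0, 2); (1, 2); (3, 4); (5, 6)] [::] 4.
Proof.
apply: (@settling_high 7 1 3 _
  [:: [:: 0]; [:: 0]; [:: 0]; [:: 1]; [:: 1]; [:: 2]; [:: 2]]) => //=; lra.
Qed.

Definition C5_edge : seq (nat * nat) := cycle_pairs 5 ++ [:: (5, 6)].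

(** Label 6 is a leaf at 5, which may have any neighbours on the cycle; the value is that of the
    5-cycle plus 1 for the pendant edge. *)
Lemma settling_C5_pendant :
  settling 7 C5_edge (others 5 (cycle_pairs 5) ++ [seq (i, 6) | i <- iota 0 5]) (7 / 2).
Proof.
apply: (@settling_low 7 2 7 _ _ [:: [:: 0; 4]; [:: 0; 1]; [:: 1; 2]; [:: 2; 3];
  [:: 3; 4]; [:: 5; 6]; [:: 5; 6]]) => //=.
- by lra.
- by rewrite /low_value; lra.
move=> H H0 H1 sub.
have := sub [:: 2] [:: 0] [:: 0; 2] [::] isT.
have := sub [:: 3] [:: 0] [:: 0; 3] [::] isT.
have := sub [:: 4] [:: 1] [:: 1; 4] [::] isT.
have := sub [:: 5] [::] [:: 5; 6] [::] isT.
have := sub [:: 5; 6] [:: 0] [:: 0; 5; 6] [::] isT.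
have := sub [:: 5; 6] [:: 1] [:: 1; 5; 6] [::] isT.
have := sub [:: 0; 5; 6] [:: 0; 2] [:: 0; 1; 2; 5; 6] [:: 0] isT.
have := sub [:: 0; 5; 6] [:: 0; 3] [:: 0; 3; 4; 5; 6] [:: 0] isT.
have := sub [:: 1; 5; 6] [:: 1; 4] [:: 0; 1; 4; 5; 6] [:: 1] isT.
have := sub [:: 0; 4; 5; 6] [:: 0; 1; 2; 5; 6] [:: 0; 1; 2; 3; 4; 5; 6] [:: 0; 5; 6] isT.
have := sub [:: 0; 3; 4; 5; 6] [:: 0; 1; 4; 5; 6] [:: 0; 1; 2; 3; 4; 5; 6] [:: 0; 4; 5; 6] isT.
have := H1 0; have := H1 1; have := H1 2; have := H1 3; have := H1 4; have := H1 5.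
rewrite /= H0; lra.
Qed.

(** Besides the 7-cycle this graph is spanned, through the chord [(0, 3)], by the 5-cycle
    [0, 3, 4, 5, 6] and the edge [(1, 2)]. One upper bound thus serves two covers. *)
Definition chorded_C7 : seq (nat * nat) := cycle_pairs 7 ++ [:: (0, 3); (2, 6); (1, 5)].

Lemma label_bound_chorded_C7 : label_bound 7 (others 7 chorded_C7) (7 / 2).
Proof.
move=> H H0 H1 sub.
have := sub [:: 2] [:: 0] [:: 0; 2] [::] isT.
have := sub [:: 3] [:: 1] [:: 1; 3] [::] isT.
have := sub [:: 4] [:: 0] [:: 0; 4] [::] isT.
have := sub [:: 5] [:: 0] [:: 0; 5] [::] isT.
have := sub [:: 6] [:: 3] [:: 3; 6] [::] isT.
have := sub [:: 0; 4] [:: 0; 2] [:: 0; 2; 3; 4] [:: 0] isT.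
have := sub [:: 0; 5] [:: 0; 3] [:: 0; 3; 4; 5] [:: 0] isT.
have := sub [:: 3; 6] [:: 1; 3] [:: 0; 1; 2; 3; 6] [:: 3] isT.
have := sub [:: 0; 3; 6] [:: 0; 3; 4] [:: 0; 3; 4; 6] [:: 0; 3] isT.
have := sub [:: 0; 3; 4; 5] [:: 0; 2; 3; 4] [:: 0; 1; 2; 3; 4; 5; 6] [:: 0; 3; 4] isT.
have := sub [:: 0; 3; 4; 6] [:: 0; 1; 2; 3; 6] [:: 0; 1; 2; 3; 4; 5; 6] [:: 0; 3; 6] isT.
have := H1 0; have := H1 1; have := H1 2; have := H1 3; have := H1 4; have := H1 5.
have := H1 6; rewrite /= H0; lra.
Qed.

Lemma settling_C7 : settling 7 (cycle_pairs 7) (others 7 chorded_C7) (7 / 2).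
Proof.
apply: (@settling_low 7 2 7 _ _ [:: [:: 0; 6]; [:: 0; 1]; [:: 1; 2]; [:: 2; 3];
  [:: 3; 4]; [:: 4; 5]; [:: 5; 6]]) => //=.
- by lra.
- by rewrite /low_value; lra.
exact: label_bound_chorded_C7.
Qed.

Definition C5_edge_in_C7 : seq (nat * nat) :=
  [:: (0, 3); (3, 4); (4, 5); (5, 6); (6, 0); (1, 2)].

Lemma settling_C5_edge_in_C7 : settling 7 C5_edge_in_C7 (others 7 chorded_C7) (7 / 2).
Proof.
apply: (@settling_low 7 2 7 _ _ [:: [:: 0; 4]; [:: 5; 6]; [:: 5; 6]; [:: 0; 1];
  [:: 1; 2]; [:: 2; 3]; [:: 3; 4]]) => //=.
- by lra.
- by rewrite /low_value; lra.
exact: label_bound_chorded_C7.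
Qed.

Definition spider_triangle : seq (nat * nat) :=
  [:: (0, 1); (0, 2); (1, 2); (0, 3); (1, 4); (2, 5); (3, 6); (4, 6); (5, 6)].

Lemma label_bound_spider_triangle :
  label_bound 7 (others 7 spider_triangle) (11 / 3).
Proof.
move=> H H0 H1 sub.
have := sub [:: 4] [:: 2] [:: 2; 4] [::] isT.
have := sub [:: 2] [:: 0] [:: 0; 2] [::] isT.
have := sub [:: 5] [:: 0] [:: 0; 5] [::] isT.
have := sub [:: 5] [:: 1] [:: 1; 5] [::] isT.
have := sub [:: 5] [:: 2] [:: 2; 5] [::] isT.
have := sub [:: 5] [:: 3] [:: 3; 5] [::] isT.
have := sub [:: 6] [:: 4] [:: 4; 6] [::] isT.
have := sub [:: 6] [:: 1] [:: 1; 4; 6] [::] isT.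
have := sub [:: 6] [:: 2] [:: 2; 5; 6] [::] isT.
have := sub [:: 2; 4] [:: 0; 2] [:: 0; 1; 2; 4] [:: 2] isT.
have := sub [:: 0; 2; 5] [:: 0; 1; 2; 4] [:: 0; 1; 2; 4; 5] [:: 0; 2] isT.
have := sub [:: 1; 5] [:: 0; 5] [:: 0; 1; 2; 5] [:: 5] isT.
have := sub [:: 1; 5] [:: 2; 5] [:: 1; 2; 5] [:: 5] isT.
have := sub [:: 2; 5] [:: 0; 5] [:: 0; 2; 5] [:: 5] isT.
have := sub [:: 3; 5] [:: 2; 5] [:: 2; 3; 5] [:: 5] isT.
have := sub [:: 2; 3; 5] [:: 1; 2; 5] [:: 0; 1; 2; 3; 5] [:: 2; 5] isT.
have := sub [:: 2; 5; 6] [:: 1; 2; 5] [:: 1; 2; 4; 5; 6] [:: 2; 5] isT.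
have := sub [:: 1; 2; 4; 5; 6] [:: 0; 1; 2; 5] [:: 0; 1; 2; 3; 4; 5; 6] [:: 1; 2; 5] isT.
have := sub [:: 0; 1; 2; 4; 5] [:: 0; 1; 2; 3; 5] [:: 0; 1; 2; 3; 4; 5; 6] [:: 0; 1; 2; 5] isT.
have := sub [:: 4; 6] [:: 2; 5; 6] [:: 2; 4; 5; 6] [:: 6] isT.
have := sub [:: 2; 4; 5; 6] [:: 1; 4; 6] [:: 1; 2; 4; 5; 6] [:: 4; 6] isT.
have := H1 0; have := H1 1; have := H1 2; have := H1 3; have := H1 4; have := H1 5.
have := H1 6; rewrite /= H0; lra.
Qed.

Lemma settling_spider_triangle : settling 7 spider_triangle (others 7 spider_triangle) (11 / 3).
Proof.
(* The triangle and the edges at 6 are used once, the other three edges twice: ten cliques, three at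
   each vertex. *)
apply: (@settling_low 7 3 10 _ _ [:: [:: 0; 1; 2]; [:: 0; 3; 4]; [:: 0; 5; 6];
  [:: 1; 2; 7]; [:: 3; 4; 8]; [:: 5; 6; 9]; [:: 7; 8; 9]]) => //=.
- by lra.
- by rewrite /low_value; lra.
exact: label_bound_spider_triangle.
Qed.

(** * Pattern lists for the search *)

Definition decided (n : nat) (items : seq item) (B : seq (nat * nat)) : bool :=
  search items B (others n B).

Definition sound_item (n : nat) (it : item) : Prop :=
  {subset it.1 <= permutations (iota 0 n)} /\ exists r, settling n it.2.1 it.2.2 r.

Lemma placed_item n P N r X B : settling n P N r -> sound_item n (placements n X B, (P, N)).
Proof. by move=> sP; split=> [s|]; [rewrite mem_filter => /andP[] | exists r]. Qed.

Lemma sorted_item n P N r ls : settling n P N r -> sound_item n (sorted_placements n ls, (P, N)).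
Proof. by move=> sP; split=> [s|]; [rewrite mem_filter => /andP[] | exists r]. Qed.

Definition items4 : seq item :=
  [:: ([:: iota 0 4], (pairs 4, [::]));
      (placements 4 matching4 matching4, (matching4, [:: (0, 2)]))].

Definition items5 : seq item :=
  [:: ([:: iota 0 5], (pairs 5, [::]));
      ([:: iota 0 5], (cycle_pairs 5, others 5 (cycle_pairs 5)));
      (placements 5 [::] [::], (triangle_edge, [:: (0, 3)]))].

(** The last two items are the two ways, up to reflection, in which a perfect matching sits in
    [hub_C5]: label 5 is matched to an end or to the middle of its three consecutive neighbours. *)
Definition items6 : seq item :=
  [:: (sorted_placements 6 [:: [:: 0; 1; 2]; [:: 3; 4; 5]; [:: 0; 3]],
        ([:: (0, 1); (0, 2); (1, 2); (3, 4); (3, 5); (4, 5)], [::]));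
      (sorted_placements 6 [:: [:: 0; 1; 2; 3]; [:: 4; 5]],
        (pairs 4 ++ [:: (4, 5)], [::]));
      (placements 6 matching6 matching6, (matching6, [:: (0, 2); (0, 4); (2, 4)]));
      (placements 6 [:: (5, 0); (1, 2); (3, 4)] matching6,
        (hub_C5, others 5 (cycle_pairs 5)));
      (placements 6 [:: (5, 1); (0, 4); (2, 3)] matching6,
        (hub_C5, others 5 (cycle_pairs 5)))].

Definition item_K3_2K2 : item :=
  (sorted_placements 7 [:: [:: 0; 1; 2]; [:: 3; 4]; [:: 5; 6]; [:: 3; 5]],
    ([:: (0, 1); (0, 2); (1, 2); (3, 4); (5, 6)], [::])).

Definition items_C7 : seq item :=
  [:: item_K3_2K2;
      (placements 7 (cycle_pairs 7) (cycle_pairs 7),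
        (cycle_pairs 7, others 7 chorded_C7))].

(** [spider_triangle] is spanned by the 5-cycle [0, 1, 4, 6, 3] and the edge [(2, 5)]; the last item
    aligns these with [C5_edge]. *)
Definition items_C5_edge : seq item :=
  [:: item_K3_2K2;
      (placements 7 C5_edge C5_edge,
        (C5_edge, others 5 (cycle_pairs 5) ++ [seq (i, 6) | i <- iota 0 5]));
      (placements 7 C5_edge_in_C7 C5_edge, (C5_edge_in_C7, others 7 chorded_C7));
      (placements 7 [:: (0, 1); (1, 4); (4, 6); (6, 3); (3, 0); (2, 5)] C5_edge,
        (spider_triangle, others 7 spider_triangle))].

(** * Cycle decomposition and reduction *)

Lemma adj_cat L1 L2 i j : adj (L1 ++ L2) i j = adj L1 i j || adj L2 i j.
Proof. by rewrite /adj !hasbE has_cat. Qed.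

Lemma adj_sym L i j : adj L i j = adj L j i.
Proof. by apply/adjP/adjP; case; auto. Qed.

Lemma adj_others n B i j : i < n -> j < n -> i != j -> adj (B ++ others n B) i j.
Proof.
wlog ij : i j / i < j.
  move=> H ni nj; case: ltngtP => // ij _; first by apply: H => //; rewrite neq_ltn ij.
  by rewrite adj_sym; apply: H => //; rewrite neq_ltn ij.
move=> _ nj _; rewrite adj_cat; have [//|nB] := boolP (adj B i j).
apply/adjP; left; rewrite mem_filter nB /=; apply/allpairsPdep.
by exists j, i; split; rewrite // mem_iota.
Qed.

Lemma decided_settled (V : finType) (e : rel V) n g (items : seq item) B :
  simple e -> labelling n g -> (forall p, p \in B -> e (g p.1) (g p.2)) ->
  (forall it, it \in items -> sound_item n it) ->
  decided n items B -> settled e.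
Proof.
move=> es gl eB itP; apply: (search_settled es gl itP eB) => i j ni nj eij.
by apply: adj_others => //; apply: contraTneq eij => ->; rewrite es.2.
Qed.

(** Each cycle occupies a block of consecutive labels; a block of length 2 lists its single edge in
    both directions. *)
Fixpoint cycles_from (o : nat) (ks : seq nat) : seq (nat * nat) :=
  if ks is k :: ks' then
    [seq (o + i, o + (i.+1 %% k)) | i <- iota 0 k] ++ cycles_from (o + k) ks'
  else [::].

Lemma cycle_nth (T : Type) (x0 : T) (e : rel T) c i : cycle e c -> i < size c ->
  e (nth x0 c i) (nth x0 c (i.+1 %% size c)).
Proof.
case: c => // x c /= /(pathP x0) H ic; have := H i; rewrite size_rcons => /(_ ic).
rewrite -[x :: rcons c x]/(rcons (x :: c) x) nth_rcons /= ic nth_rcons.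
case: ltngtP => [lt|lt|eq]; first by rewrite modn_small.
  by move: ic; rewrite ltnS leqNgt lt.
by rewrite eq modnn.
Qed.

Lemma cycles_from_edge (T : Type) (x0 : T) (e : rel T) pre ss :
  all (cycle e) ss ->
  forall p, p \in cycles_from (size pre) (shape ss) ->
    e (nth x0 (pre ++ flatten ss) p.1) (nth x0 (pre ++ flatten ss) p.2).
Proof.
elim: ss pre => //= c ss IH pre /andP[ec ess] p; rewrite mem_cat => /orP[].
  case/mapP => i; rewrite mem_iota add0n /= => ic -> /=.
  have mc : i.+1 %% size c < size c by rewrite ltn_pmod // (leq_ltn_trans _ ic).
  have nthE u : u < size c ->
      nth x0 (pre ++ c ++ flatten ss) (size pre + u) = nth x0 c u.
    by move=> uc; rewrite nth_cat ltnNge leq_addr addKn nth_cat uc.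
  by rewrite !nthE //; apply: cycle_nth.
by rewrite catA -size_cat; apply: IH.
Qed.

Lemma split_pairs (T : Type) (e : rel T) (c : seq T) : (forall u v, e u v = e v u) ->
  sorted e c -> ~~ odd (size c) ->
  exists ss, flatten ss = c /\ all (fun d => cycle e d && (size d == 2)) ss.
Proof.
move=> esym; have [k] := ubnP (size c); elim: k c => // k IH [|x [|y c]] //= ck.
  by exists [::].
case/andP=> exy yc; rewrite !negbK => oc.
have [|||ss [<- ess]] := IH c.
- exact: ltnW.
- by apply: path_sorted yc.
- exact: oc.
by exists ([:: x; y] :: ss); rewrite /= exy esym exy ess.
Qed.

Definition small_cycle (V : finType) (e : rel V) (c : seq V) : bool :=
  cycle e c && ((size c == 2) || odd (size c) && (2 < size c)).

(** Orbits of [f] run along edges and have length at least 2, as there are no loops. Odd ones are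
    kept as cycles, even ones are cut into edges. *)
Lemma perm_cycles (V : finType) (e : rel V) (f : V -> V) (S : {set V}) :
  simple e -> injective f -> (forall v, e (f v) v) -> {homo f : v / v \in S} ->
  exists ss, [/\ uniq (flatten ss), flatten ss =i S & all (small_cycle e) ss].
Proof.
move=> [esym eirr] finj ef; have [k] := ubnP #|S|; elim: k S => // k IH S Sk fS.
have [->|[x xS]] := set_0Vmem S.
  by exists [::]; split=> // v; rewrite inE.
have fe : subrel (frel f) e by move=> u v /eqP <-; rewrite esym.
have oS v : v \in orbit f x -> v \in S.
  rewrite -fconnect_orbit => /iter_findex <-; elim: (findex f x v) => //= n IHn.
  exact: fS.
pose S' := S :\: [set v in orbit f x].
have [||ss [uss ssS ess]] := IH S'.
- rewrite -ltnS; apply: leq_trans Sk; rewrite ltnS; apply: proper_card.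
  apply/properP; split; first exact: subsetDl.
  by exists x => //; rewrite !inE -fconnect_orbit connect0.
- move=> v; rewrite !inE => /andP[vo /fS ->]; rewrite andbT.
  apply: contra vo; rewrite -!fconnect_orbit => H.
  by rewrite (same_fconnect1_r finj).
have cyc : cycle e (orbit f x) by apply: sub_cycle fe _ _; apply: cycle_orbit.
have sz : 1 < size (orbit f x).
  rewrite size_orbit ltnNge; apply/negP => o1.
  have : f x = x.
    have := iter_order finj x; have := order_gt0 f x.
    by case: (order f x) o1 => [|[|]].
  by move=> fx; have := ef x; rewrite fx eirr.
have mem_fl ds : flatten ds = orbit f x ->
    uniq (flatten (ds ++ ss)) /\ flatten (ds ++ ss) =i S.
  move=> dE; rewrite flatten_cat dE; split.
    rewrite cat_uniq orbit_uniq uss andbT /=; apply/hasPn => v; rewrite ssS.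
    by rewrite !inE => /andP[].
  move=> v; rewrite mem_cat ssS !inE.
  by case: (boolP (v \in orbit f x)) => //= /oS ->.
have [o|no] := boolP (odd (size (orbit f x))).
  exists ([:: orbit f x] ++ ss); have [|u m] := mem_fl [:: orbit f x]; first by rewrite /= cats0.
  split=> //=; rewrite ess andbT /small_cycle cyc o /=.
  by case: (size _) sz o => [|[|[|]]].
have [|ds [dE eds]] := split_pairs esym _ no.
  by case: (orbit f x) cyc => //= y c; rewrite rcons_path => /andP[].
have [u m] := mem_fl ds dE; exists (ds ++ ss); split=> //.
rewrite all_cat ess andbT; apply: sub_all eds => d /andP[ed sd].
by rewrite /small_cycle ed sd.
Qed.

(** The partitions of the integers up to 7 into parts that are 2 or odd and at least 3. *)
Definition small_shapes : seq (seq nat) :=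
  [:: [:: 2]; [:: 3]; [:: 2; 2]; [:: 5]; [:: 3; 2]; [:: 2; 2; 2]; [:: 3; 3]; [:: 7];
      [:: 5; 2]; [:: 3; 2; 2]].

Lemma sorted_shape_lt8 (ks : seq nat) :
  all (fun k => (k == 2) || odd k && (2 < k)) ks -> sorted geq ks -> 0 < sumn ks < 8 ->
  ks \in small_shapes.
Proof.
have big k : (k == 2) || odd k && (2 < k) -> 1 < k by case: k => [|[|]].
case: ks => [|a [|b [|c [|d ks]]]] //=.
- by rewrite andbT addn0 => + _; case: a => [|[|[|[|[|[|[|[|a]]]]]]]].
- rewrite !andbT !addn0.
  by case: a => [|[|[|[|[|[|[|[|a]]]]]]]]; case: b => [|[|[|[|[|[|[|[|b]]]]]]]].
- rewrite !andbT !addn0.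
  case: a => [|[|[|[|[|[|[|[|a]]]]]]]]; case: b => [|[|[|[|[|[|[|[|b]]]]]]]];
  by case: c => [|[|[|[|[|[|[|[|c]]]]]]]].
(* Four parts of size at least 2 already sum to 8. *)
- case/and5P => /big a1 /big b1 /big c1 /big d1 _ _ /andP[_ lt].
  have: 2 + (2 + (2 + (2 + 0))) <= a + (b + (c + (d + sumn ks))) by rewrite !leq_add.
  by rewrite leqNgt lt.
Qed.

Lemma decided_matching4 : decided 4 items4 matching4.
Proof. by vm_compute. Qed.

Lemma decided_C5 : decided 5 items5 (cycle_pairs 5).
Proof. by vm_compute. Qed.

Lemma decided_triangle_edge : decided 5 items5 triangle_edge.
Proof. by vm_compute. Qed.

Lemma decided_matching6 : decided 6 items6 matching6.
Proof. by vm_compute. Qed.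

Lemma decided_C7 : decided 7 items_C7 (cycle_pairs 7).
Proof. by vm_compute. Qed.

Lemma decided_C5_edge : decided 7 items_C5_edge C5_edge.
Proof. by vm_compute. Qed.

Lemma iota_item n P N r : settling n P N r -> sound_item n ([:: iota 0 n], (P, N)).
Proof.
by move=> sP; split=> [s|]; [rewrite inE => /eqP ->; rewrite mem_permutations | exists r].
Qed.

Lemma items5_sound it : it \in items5 -> sound_item 5 it.
Proof.
rewrite !inE => /or3P[] /eqP->; last exact/placed_item/settling_triangle_edge.
  exact/iota_item/settling_K5.
exact/iota_item/settling_C5.
Qed.

(** For [[:: 2]], [[:: 3]], [[:: 3; 3]] and [[:: 3; 2; 2]] the cycles alone settle every graph they
    span; the other shapes go through the search. *)
Lemma shape_settled (V : finType) (e : rel V) g ks :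
  simple e -> labelling (sumn ks) g ->
  (forall p, p \in cycles_from 0 ks -> e (g p.1) (g p.2)) ->
  ks \in small_shapes ->
  settled e.
Proof.
move=> es gl eks.
have sub P : all (fun p => adj (cycles_from 0 ks) p.1 p.2) P ->
    forall p, p \in P -> e (g p.1) (g p.2).
  by move=> /allP H p /H /adjP [] /eks //=; rewrite es.1.
have fitP P : all (fun p => adj (cycles_from 0 ks) p.1 p.2) P -> fits e g P [::].
  by move=> H; split=> //; apply: sub.
rewrite !inE => ksE; move: gl sub fitP.
case/or4P: ksE => [/eqP->|/eqP->|/eqP->|]; [| | |case/or4P=> [/eqP->|/eqP->|/eqP->|]];
  [| | | | | |case/or4P=> /eqP->]; move=> gl sub fitP.
- by apply: (settling_settled settling_K2 es gl); apply: fitP.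
- by apply: (settling_settled settling_K3 es gl); apply: fitP.
- apply: (decided_settled es gl _ _ decided_matching4); first exact: sub.
  move=> it; rewrite !inE => /orP[] /eqP->; last exact/placed_item/settling_2K2.
  exact/iota_item/settling_K4.
- apply: (decided_settled es gl _ _ decided_C5); [exact: sub | exact: items5_sound].
- apply: (decided_settled es gl _ _ decided_triangle_edge); [exact: sub | exact: items5_sound].
- apply: (decided_settled es gl _ _ decided_matching6); first exact: sub.
  move=> it; rewrite !inE => /or4P[/eqP->|/eqP->|/eqP->|/orP[] /eqP->].
  + exact/sorted_item/settling_2K3.
  + exact/sorted_item/settling_K4_edge.
  + exact/placed_item/settling_3K2.
  + exact/placed_item/settling_hub_C5.
  + exact/placed_item/settling_hub_C5.
- by apply: (settling_settled settling_2K3 es gl); apply: fitP.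
- apply: (decided_settled es gl _ _ decided_C7); first exact: sub.
  move=> it; rewrite !inE => /orP[] /eqP->; last exact/placed_item/settling_C7.
  exact/sorted_item/settling_K3_2K2.
- apply: (decided_settled es gl _ _ decided_C5_edge); first exact: sub.
  move=> it; rewrite !inE => /or4P[] /eqP->.
  + exact/sorted_item/settling_K3_2K2.
  + exact/placed_item/settling_C5_pendant.
  + exact/placed_item/settling_C5_edge_in_C7.
  + exact/placed_item/settling_spider_triangle.
- by apply: (settling_settled settling_K3_2K2 es gl); apply: fitP.
Qed.

(** The clique named [c] consists of [c] and its preimage under [f], so [v] lies in the two cliques
    [v] and [f v]. *)
Lemma half_cover (V : finType) (e : rel V) (f : V -> V) :
  simple e -> injective f -> (forall v, e (f v) v) -> clique_cover e (INR #|V| / 2).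
Proof.
move=> [esym eirr] finj ef.
exists 2, V, (fun v (j : 'I_2) => if val j == 0 then v else f v); split=> //.
- have fv v : f v <> v by move=> fv; have := ef v; rewrite fv eirr.
  move=> v [[|[|//]] i2] [[|[|//]] j2] //= E; apply: val_inj => //=.
    by case: (fv v).
  by case: (fv v).
- move=> u v [[|[|//]] i2] [[|[|//]] j2] /=; first by left.
  + by move=> ->; right.
  + by move=> <-; right; rewrite esym.
  + by move/finj; left.
- by rewrite /=; field.
Qed.

Lemma perm_settled (V : finType) (e : rel V) (f : V -> V) :
  simple e -> injective f -> (forall v, e (f v) v) -> settled e.
Proof.
move=> es finj ef; have [V0|Vgt0] := posnP #|V|.
  (* The empty graph, which is what remains when crowns exhaust the vertices. *)
  exists 0%R.
    exists 1, V, (fun v _ => v); split=> //; last by rewrite V0 /=; field.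
    by move=> v i j _; rewrite !ord1.
    by move=> u v _ _; left.
  right; split; first by left.
  move=> h [h0 _ _ _ _]; have -> : [set: V] = set0.
    by apply/eqP; rewrite -cards_eq0 cardsT V0.
  rewrite h0; exact: Rle_refl.
have [n8|n7] := leqP 8 #|V|.
  exists (INR #|V| / 2)%R; first exact: half_cover ef.
  left; have := le_INR _ _ (leP n8); rewrite [INR 8]/=; lra.
have [x0 _] := card_gt0P Vgt0.
have [//|ss [uss ssV css]] := @perm_cycles V e f setT es finj ef.
pose ts := sort (fun c d => size d <= size c) ss.
have tss : perm_eq ts ss by apply/permPl/perm_sort.
have fl : perm_eq (flatten ts) (flatten ss) by apply: perm_flatten.
have nts : sumn (shape ts) = #|V|.
  rewrite -size_flatten (perm_size fl) -(card_uniqP uss); apply: eq_card => v.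
  by rewrite ssV inE.
have cts : all (small_cycle e) ts by rewrite (perm_all _ tss).
apply: (@shape_settled V e (nth x0 (flatten ts)) (shape ts)) => //.
- rewrite -size_flatten; split=> [i j ni nj /eqP|v].
    by rewrite nth_uniq ?(perm_uniq fl) // => /eqP.
  have vts : v \in flatten ts by rewrite (perm_mem fl) ssV inE.
  by exists (index v (flatten ts)); rewrite ?index_mem ?nth_index.
- apply: (@cycles_from_edge V x0 e [::] ts); apply: sub_all cts => c.
  by case/andP.
apply: sorted_shape_lt8; last by rewrite nts Vgt0.
  by rewrite /shape all_map; apply: sub_all cts => c /andP[].
rewrite /shape sorted_map; apply: sort_sorted => c d; exact: leq_total.
Qed.

(** * A crown, or a permutation along edges *)

Definition crown (V : finType) (e : rel V) (I S : {set V}) (g : V -> V) : Prop :=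
  [/\ I != set0, [disjoint I & S], forall v, v \in I -> nbrs e v \subset S,
      {in S &, injective g} & forall s, s \in S -> g s \in I /\ e (g s) s].

Lemma crown_or_perm (V : finType) (e : rel V) : simple e ->
  (exists I S g, crown e I S g) \/
  (exists2 f : V -> V, injective f & forall v, e (f v) v).
Proof.
move=> [esym eirr].
pose deficient (I : {set V}) :=
  [forall u in I, forall v in I, ~~ e u v] && (#|nbhd e I| < #|I|).
have [I0 dI0|full] := pickP deficient.
  (* Minimality of the deficient set [I] gives Hall's condition on [I :\ i], and
     [#|nbhd e I| < #|I|] makes the matching onto [nbhd e I]; its inverse is [g]. *)
  left; have [I /andP[/forall_inP indep defI] Imin] := arg_minnP (fun I : {set V} => #|I|) dI0.
  have ind u v : u \in I -> v \in I -> ~~ e u v by move=> uI; move: v; apply/forall_inP/indep.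
  have /card_gt0P [i iI] : 0 < #|I| by apply: leq_ltn_trans defI.
  have [X XJ|f [finj fJ]] := @hall V e (I :\ i).
    have XI : X \subset I := subset_trans XJ (subsetDl _ _).
    rewrite leqNgt; apply/negP => defX.
    have : #|I| <= #|X|.
      apply: Imin; rewrite /deficient defX andbT.
      apply/forall_inP => u uX; apply/forall_inP => v vX.
      by apply: ind; apply: (subsetP XI).
    rewrite leqNgt => /negP; apply; apply: leq_ltn_trans (subset_leq_card XJ) _.
    by rewrite (cardsD1 i I) iI.
  have fS : f @: (I :\ i) = nbhd e I.
    apply/eqP; rewrite eqEcard card_in_imset //; apply/andP; split.
      apply/subsetP => _ /imsetP [x xJ ->]; apply/nbhdP; exists x; last exact: fJ.
      by move: xJ; rewrite inE => /andP[].
    by move: defI; rewrite [X in _ < X](cardsD1 i) iI.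
  pose g s := odflt s [pick x in I :\ i | f x == s].
  have gP s : s \in nbhd e I -> g s \in I :\ i /\ f (g s) = s.
    rewrite -fS /g => /imsetP [x xJ ->]; case: pickP => [y /andP[yJ /eqP fy]|/(_ x)] //=.
    by rewrite xJ eqxx.
  exists I, (nbhd e I), g; split.
  - by apply/set0Pn; exists i.
  - rewrite -setI_eq0; apply/eqP/setP => v; rewrite in_setI in_set0; apply/negP => /andP[vI].
    by case/nbhdP => x xI; apply/negP/ind.
  - by move=> v vI; apply: bigcup_sup.
  - by move=> s s' /gP[_ E] /gP[_ E'] ss'; rewrite -E -E' ss'.
  - move=> s /gP [gI fg]; split; first by move: gI; rewrite inE => /andP[].
    by rewrite esym -{1}fg; apply: fJ.
right; have [X _|f [finj ef]] := @hall V e setT; last first.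
  by exists f => [u v|v]; [apply: finj; rewrite inE | apply: ef; rewrite inE].
(* [X0] is independent, hence not deficient, and its neighbourhood misses [X]; with [X :&: nbhd e X]
   it accounts for at least [#|X|] elements of [nbhd e X]. *)
pose X0 := X :\: nbhd e X.
have X0X : X0 \subset X := subsetDl _ _.
have hX0 : #|X0| <= #|nbhd e X0|.
  have := full X0; rewrite /deficient => /negbT; rewrite negb_and -leqNgt => /orP[|//].
  case/negP; apply/forall_inP => u; rewrite inE => /andP[uN _].
  apply/forall_inP => v /(subsetP X0X) vX.
  by apply: contra uN => euv; apply/nbhdP; exists v.
have dis : [disjoint X :&: nbhd e X & nbhd e X0].
  rewrite -setI_eq0; apply/eqP/setP => v; rewrite !in_setI in_set0.
  apply/negP => /andP[/andP[vX _] /nbhdP [x]]; rewrite inE => /andP[/negP xN _] evx.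
  by apply: xN; apply/nbhdP; exists v; rewrite // esym.
have -> : #|X| = #|X :&: nbhd e X| + #|X0| by rewrite cardsID.
apply: leq_trans (_ : #|X :&: nbhd e X| + #|nbhd e X0| <= _); first by rewrite leq_add2l.
have := cardsU (X :&: nbhd e X) (nbhd e X0).
rewrite (disjoint_setI0 dis) cards0 subn0 => <-; apply: subset_leq_card.
by rewrite subUset subsetIr nbhdS.
Qed.

(** Adding integers leads to no new value below 4, so putting back a crown stays within the list. *)
Lemma low_valueD r k : low_value r -> (r + INR k < 4)%R -> low_value (r + INR k).
Proof.
move=> rl lt; have r0 : (0 <= r)%R by move: rl; rewrite /low_value; lra.
have k4 : k < 4.
  by rewrite ltnNge; apply/negP => /leP/le_INR; rewrite [INR 4]/=; lra.
move: k k4 lt => [|[|[|[|//]]]] _ /=; move: rl; rewrite /low_value; lra.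
Qed.

Lemma crown_settled (V : finType) (e : rel V) I S g : simple e -> crown e I S g ->
  settled (@sub_rel V e (I :|: S)) -> settled e.
Proof.
move=> es [I0 dis NI ginj gI] [r rc rs]; exists (r + INR #|S|)%R.
  exact: crown_cover es.1 dis I0 ginj gI rc.
case: (Rle_lt_dec 4 (r + INR #|S|)) => [|lt]; [by left | right].
case: rs => [r4|[rl rs]]; first by have := pos_INR #|S|; lra.
by split; [apply: low_valueD | apply: crown_shannon NI rs].
Qed.

Lemma simple_settled (V : finType) (e : rel V) : simple e -> settled e.
Proof.
have [k] := ubnP #|V|; elim: k V e => // k IH V e Vk es.
have [[I [S [g crw]]]|[f finj ef]] := crown_or_perm es; last exact: perm_settled finj ef.
apply: (crown_settled es crw); apply: IH; last by split=> [u v|u]; [apply: es.1 | apply: es.2].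
rewrite -ltnS; apply: leq_trans Vk; rewrite ltnS card_sig.
have [/set0Pn [i iI] _ _ _ _] := crw.
apply: proper_card; apply/properP; split; first exact/subsetP.
by exists i; rewrite // !inE iI.
Qed.

(** * Realizing the values and conclusion *)

Lemma fits_exists n (P N : seq (nat * nat)) : 0 < n ->
  all (fun p => [&& p.1 < n, p.2 < n & p.1 != p.2]) P ->
  all (fun p => [&& p.1 < n, p.2 < n & ~~ adj P p.1 p.2]) N ->
  exists (e : rel 'I_n) g, [/\ simple e, labelling n g & fits e g P N].
Proof.
case: n => // n _ /allP Pn /allP Nn.
exists (fun u v : 'I_n.+1 => (u != v) && adj P u v), (@inord n); split.
- by split=> [u v|u]; rewrite ?eqxx // eq_sym adj_sym.
- split=> [i j ni nj /(congr1 val)|v]; first by rewrite /= !inordK.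
  by exists v; rewrite ?inord_val.
- split=> p.
    move=> pP; have /and3P[p1 p2 ne] := Pn p pP.
    rewrite !inordK // -val_eqE /= !inordK // ne /=; apply/adjP; left.
    by rewrite -surjective_pairing.
  move=> pN; have /and3P[p1 p2 nadj] := Nn p pN.
  by rewrite !inordK // (negbTE nadj) andbF.
Qed.

Lemma settling_entropy n P N r : settling n P N r -> (r < 4)%R -> 0 < n ->
  all (fun p => [&& p.1 < n, p.2 < n & p.1 != p.2]) P ->
  all (fun p => [&& p.1 < n, p.2 < n & ~~ adj P p.1 p.2]) N ->
  exists n (e : rel 'I_n), simple_graph e /\ is_entropy e r.
Proof.
move=> sP r4 n0 Pn Nn; have [e [g [es gl eP]]] := fits_exists n0 Pn Nn.
exists n, e; split=> //; have [rc [|[_ rs]]] := sP _ e g es gl eP; first by lra.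
exact: entropy_eq.
Qed.

Lemma settling_K1 : settling 1 [::] [::] 0.
Proof.
apply: (@settling_low 1 1 1 _ _ [:: [:: 0]]) => //=.
- by lra.
- by rewrite /low_value; lra.
move=> H H0 H1 sub; have := sub [::] [::] [:: 0] [::] isT; rewrite /= H0; lra.
Qed.

Lemma label_bound_K5 : label_bound 5 [::] 4.
Proof.
move=> H H0 H1 sub; have := sub [:: 0] [:: 1] [:: 0; 1] [::] isT.
have := sub [:: 0; 1] [:: 2] [:: 0; 1; 2] [::] isT.
have := sub [:: 0; 1; 2] [:: 3] [:: 0; 1; 2; 3; 4] [::] isT.
have := H1 0; have := H1 1; have := H1 2; have := H1 3; rewrite /= H0; lra.
Qed.

(** [settling_K5] is proved through the alternative [4 <= r] and yields only the cover, so the upper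
    bound comes from [label_bound_K5]. *)
Lemma entropy_K5 : exists n (e : rel 'I_n), simple_graph e /\ is_entropy e 4%R.
Proof.
have [//|//|//|e [g [es gl eP]]] := @fits_exists 5 (pairs 5) [::].
exists 5, e; split=> //; have [rc _] := settling_K5 es gl eP.
by apply: entropy_eq rc _; apply: label_shannon_bound es gl eP label_bound_K5.
Qed.

Theorem theorem4 (h : R) :
  ((exists (n : nat) (e : rel 'I_n), simple_graph e /\ is_entropy e h)
   /\ (0 <= h <= 4)%R)
  <->
  (h = 0 \/ h = 1 \/ h = 2 \/ h = 5/2 \/ h = 3 \/ h = 7/2 \/ h = 11/3 \/ h = 4)%R.
Proof.
split=> [[[n [e [es eh]]] [h0 h4]]|].
  have [r rc [r4|[rl rs]]] := simple_settled (es : simple e).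
    have := clique_cover_le_entropy rc eh; lra.
  have -> : h = r.
    by apply: Rle_antisym; [apply: entropy_le_shannon rs eh | apply: clique_cover_le_entropy rc eh].
  by move: rl; rewrite /low_value; tauto.
move=> hE; split; last by lra.
case: hE => [|[|[|[|[|[|[|]]]]]]] ->.
- by apply: (settling_entropy settling_K1) => //; lra.
- by apply: (settling_entropy settling_K2) => //; lra.
- by apply: (settling_entropy settling_K3) => //; lra.
- by apply: (settling_entropy settling_C5) => //; lra.
- by apply: (settling_entropy settling_K4) => //; lra.
- by apply: (settling_entropy settling_C7) => //; lra.
- by apply: (settling_entropy settling_spider_triangle) => //; lra.
- exact: entropy_K5.
Qed.
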